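(* Let $G$ be a finite group with $|G|\ge 3$. 1. If $G$ satisfies Property P, then (i) $\Delta(G)$ is a finite interval with $\min\Delta(G)=1$, (ii) $\daleth^{*}(G)$ is a finite interval with $\min\daleth^{*}(G)=3$, and (iii) $\mathsf{Ca}(G)$ is a finite interval with $\min\mathsf{Ca}(G)=3$ if $\mathsf D(G)=3$, and $\min\mathsf{Ca}(G)=2$ if $\mathsf D(G)\ge 4$. 2. If either $G$ is abelian, or $|G'|=2$ and the Sylow $2$-subgroup of $G$ is minimal non-abelian, then the monoid $\mathcal B(G)$ is seminormal and $\Delta(G)$, $\daleth^{*}(G)$, and $\mathsf{Ca}(G)$ are all finite intervals.
   Context: Groups are written multiplicatively with identity $1_G$; $G'$ is the commutator subgroup. A finite group is minimal non-abelian if it is non-abelian and every proper subgroup is abelian. A finite interval is a set $[a,b]=\{x\in\mathbb Z : a\le x\le b\}$ of integers. Sequences. A sequence over $G$ is a finite collection $S=g_1\cdot\ldots\cdot g_\ell$ of elements of $G$, repetition allowed and order disregarded, i.e. an element of the free abelian monoid $\mathcal F(G)$ with basis $G$; the operation $\cdot$ is concatenation of sequences, and $|S|=\ell$. $S$ is product-one if its terms can be ordered so that their product in $G$ equals $1_G$ (the empty sequence is product-one). $\mathcal B(G)$ is the monoid of all product-one sequences over $G$ under concatenation. $\mathcal A(G)$ is its set of atoms: the non-empty product-one sequences that are not the concatenation of two non-empty product-one sequences. $\mathsf D(G)=\sup\{|S| : S\in\mathcal A(G)\}$ is the large Davenport constant. Property P for $G$: whenever $g_1\cdot\ldots\cdot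 g_\ell\in\mathcal A(G)$ and $g_1=h_1h_2$ with $h_1,h_2\in G$, the sequence $h_1\cdot h_2\cdot g_2\cdot\ldots\cdot g_\ell\in\mathcal B(G)$ is either an atom or a product of only two atoms (that is, in every factorization of this sequence into atoms, at most two atoms occur). Factorizations. For $S\in\mathcal B(G)$, a factorization of $S$ is an element $z$ of the free abelian monoid with basis $\mathcal A(G)$ (a finite multiset of atoms) whose atoms concatenate to $S$; $|z|$ is its number of atoms counted with multiplicity; $\mathsf Z(S)$ is the set of all factorizations of $S$ and $\mathsf L(S)=\{|z| : z\in\mathsf Z(S)\}$. Set of distances. For $A\subseteq\mathbb Z$, $\Delta(A)$ is the set of all positive integers $d$ for which there is $\ell\in A$ with $A\cap[\ell,\ell+d]=\{\ell,\ell+d\}$. $\Delta(G)=\bigcup_{S\in\mathcal B(G)}\Delta(\mathsf L(S))$. $\daleth^{*}(G)=\{\min(\mathsf L(S)\setminus\{2\}) : S\in\mathcal B(G),\ 2\in\mathsf L(S),\ \mathsf L(S)\ne\{2\}\}$. Catenary degrees. For factorizations $z,z'$, write $z=\gcd(z,z')\,y$, $z'=\gcd(z,z')\,y'$ (gcd in the free abelian monoid on atoms) and set $\mathsf d(z,z')=\max\{|y|,|y'|\}$. For $S\in\mathcal B(G)$, $\mathsf c(S)$ is the smallest $N\in\mathbb N_0\cup\{\infty\}$ such that any two $z,z'\in\mathsf Z(S)$ can be joined by a finite sequence $z=z_0,z_1,\ldots,z_k=z'$ in $\mathsf Z(S)$ with $\mathsf d(z_{i-1},z_i)\le N$ for all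 $i\in[1,k]$. $\mathsf{Ca}(G)=\{\mathsf c(S) : S\in\mathcal B(G),\ \mathsf c(S)\ge 2\}$. Seminormality. A commutative cancellative monoid $H$ with quotient group $\mathsf q(H)$ is seminormal if $x\in\mathsf q(H)$ with $x^2,x^3\in H$ implies $x\in H$. *)

(* Defs.v *)
From HB Require Import structures.
From mathcomp Require Import all_boot all_order all_algebra all_fingroup.
From mathcomp Require Import all_solvable.
From mathcomp Require Import finmap multiset.
From mathcomp Require Import all_classical constructive_ereal.

Set Implicit Arguments.
Unset Strict Implicit.
Unset Printing Implicit Defensive.

Import Order.TTheory GRing.Theory Num.Theory.
Local Open Scope mset_scope.
Local Open Scope ring_scope.
Local Open Scope classical_set_scope.

(* The free abelian monoid with basis X is {mset X}: concatenation is `+`,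
   the empty sequence is mset0, the gcd is `&`, the length is size.  Elements
   of N_0 with infinity adjoined are represented by the nonnegative elements
   of \bar int. *)

Definition is_min d (T : porderType d) (A : set T) (m : T) : Prop :=
  A m /\ lbound A m.

(* As for [a, b] in general, a > b is allowed and gives the empty interval. *)
Definition finite_interval (A : set int) : Prop :=
  exists a b : int, A = [set` `[a, b]].

Definition ext_finite_interval (A : set (\bar int)) : Prop :=
  exists2 I : set int, finite_interval I & A = EFin @` I.

Definition set_of_distances (A : set int) : set int :=
  [set d | 0 < d /\
    exists2 l, A l & A `&` [set` `[l, l + d]] = [set l; l + d]].

(* H stands for a submonoid of an abelian group, written additively, so that
   the quotient group of H is the subgroup of all differences. *)
Definition quotient_group (V : zmodType) (H : set V) : set V :=
  [set x | exists a b, [/\ H a, H b & x = a - b]].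

Definition seminormal (V : zmodType) (H : set V) : Prop :=
  forall x, quotient_group H x -> H (x *+ 2) -> H (x *+ 3) -> H x.

Definition minimal_nonabelian (gT : finGroupType) (P : {group gT}) : Prop :=
  ~~ abelian P /\ forall H : {group gT}, H \proper P -> abelian H.

Section ProductOneSequences.
Variable gT : finGroupType.
Implicit Types (S T U : {mset gT}) (z : {mset {mset gT}}).

Definition product_one : set {mset gT} :=
  [set S : {mset gT} | exists2 s : seq gT, perm_eq s S & (\prod_(g <- s) g = 1)%g].

Definition atom : set {mset gT} :=
  [set S : {mset gT} | [/\ S <> mset0, product_one S &
    forall T U, product_one T -> product_one U -> S = (T `+` U)%mset ->
      T = mset0 \/ U = mset0]].

(* The large Davenport constant; suprema always exist in \bar int. *)
Definition davenport : \bar int :=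
  supremum 0%E [set (size S)%:Z%:E | S in atom].

Definition factorizations S : set {mset {mset gT}} :=
  [set z : {mset {mset gT}} | (forall T, T \in z -> atom T) /\
           \big[msetD/mset0]_(T <- z) T = S].

Definition lengths S : set int := [set (size z)%:Z | z in factorizations S].

(* The sequence h1 . h2 . T is product-one because g . T is; it is an atom or a
   product of only two atoms when no factorization has more than two atoms. *)
Definition property_P : Prop :=
  forall (g h1 h2 : gT) T, atom (g +` T)%mset -> g = (h1 * h2)%g ->
  forall z, factorizations (h1 +` (h2 +` T))%mset z -> (size z <= 2)%N.

Definition Delta : set int :=
  \bigcup_(S in product_one) set_of_distances (lengths S).

Definition daleth_star : set int :=
  [set m | exists S, [/\ product_one S, lengths S 2, lengths S <> [set 2] &
                         is_min (lengths S `\ 2) m]].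

Definition fact_dist z z' : nat :=
  maxn (size (z `\` (z `&` z'))%mset) (size (z' `\` (z `&` z'))%mset).

Definition chain_bound S (N : \bar int) : Prop :=
  (0 <= N)%E /\
  forall z z', factorizations S z -> factorizations S z' ->
  exists s : seq {mset {mset gT}},
    [/\ forall y, y \in s -> factorizations S y,
        path (fun y y' => ((fact_dist y y')%:Z%:E <= N)%E) z s &
        last z s = z'].

Definition catenary_degree S (N : \bar int) : Prop :=
  is_min (chain_bound S) N.

Definition Ca : set (\bar int) :=
  [set N | exists S, [/\ product_one S, catenary_degree S N & (2%:E <= N)%E]].

(* The monoid of product-one sequences, embedded by multiplicities in the
   free abelian group of maps gT -> int. *)
Definition product_one_monoid : set {ffun gT -> int} :=
  [set [ffun g => (S g)%:Z] | S in product_one].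

End ProductOneSequences.

(* Main.v *)
Require Import Defs.
From HB Require Import structures.
From mathcomp Require Import all_boot all_order all_algebra all_fingroup.
From mathcomp Require Import all_solvable.
From mathcomp Require Import finmap multiset.
From mathcomp Require Import all_classical constructive_ereal.
From mathcomp Require Import zify.

Set Implicit Arguments.
Unset Strict Implicit.
Unset Printing Implicit Defensive.

(** The whole argument rests on one construction.  Let z and z' be different
    factorizations of a sequence S, with z' not longer than z.  If, for every
    atom of z', all its terms lay in a single atom of z, then z would be a coarser
    decomposition of S, hence shorter.  So an ordering with product one of some
    atom of z' has neighbours g, h that lie in different atoms of z
    ([straddling_pair]).  Replace g and h by the single term g h
    ([merge_separated]).  The result S' is shorter than S, the merge turns z'
    into a factorization of S' of the same length, and the two atoms of z
    that contain g and h combine into one product-one sequence, the other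
    atoms being untouched.  Conversely, Property P says that cutting g h back
    into g and h replaces one atom of a factorization of S' by one or two
    atoms, so it raises the length by at most one ([split_size]).

    Lengths.  Let k be a length of S, let the next one be at least k + e with
    e > 1, and choose z' of length k.  Then S' has the length k, has a larger
    length, and its next length is at least k + e - 1.  If it is not equal to
    k + e - 1 the argument is repeated with S', and it ends because S' is shorter
    ([gap_pred]).  With k arbitrary this makes the set of distances an interval;
    with k = 2 it does the same for the set daleth*.

    Catenary degrees.  Let S be a shortest sequence with catenary degree above
    n, where n > 2.  Factorizations of S with a common atom are connected by
    n-chains, since the rest is a shorter sequence.  Take z and z' that are not
    connected; one of them, say z, has more than n atoms.  If the catenary degree
    of S' were at most n - 1, then cutting g h apart along a chain for S' would
    give an n-chain for S that ends in z' and starts in a factorization with an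
    atom in common with z.  So S' has catenary degree n ([catenary_pred]).

    Finiteness.  The catenary degrees of a finite group are bounded: there are
    finitely many atoms, and Dickson's lemma applies to pairs of factorizations of
    one sequence ([cat_bound_uniform]).  A bound for the catenary degrees bounds
    the gaps between lengths as well.

    Minima.  If g, h and g h differ from 1, then the product of the atoms
    g, h, (g h)^-1 and g^-1, h^-1, g h has the lengths 2 and 3 and
    catenary degree 3 ([lengths_2_3]).  Given an atom with at least four terms,
    merging leads to an atom with exactly four, from which a sequence
    of catenary degree 2 is built ([catenary_degree_2]).  If all atoms have at most
    three terms then the group is abelian, and two atoms never have the
    same product as two other atoms ([short_atoms_pairs]).

    The second part.  If the commutator subgroup has order at most 2 then it is
    central, all orderings of a sequence have the same product modulo it, and if two
    terms do not commute then both elements of the coset occur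
    ([po_noncommuting]).  Seminormality follows at once.  Property P
    holds if, moreover, every element that commutes with two non-commuting elements
    is central ([property_P_small_derived]); this is vacuous for abelian groups, and
    otherwise true because two non-commuting elements of a minimal
    non-abelian Sylow 2-subgroup generate it ([minimal_nonabelian_center]). *)

(** * Multisets *)

Section Multisets.
Local Open Scope mset_scope.
Variable K : choiceType.
Implicit Types (A B C : {mset K}) (z w : {mset {mset K}}).

HB.instance Definition _ := Monoid.isComLaw.Build {mset K} mset0 (@msetD K)
  (@msetDA K) (@msetDC K) (@mset0D K).

Lemma perm_msetD A B : perm_eq (A `+` B) (A ++ B).
Proof. by apply/allP => x _ /=; rewrite count_cat !count_mem_mset msetE2. Qed.

Lemma size_msetD A B : size (A `+` B) = size A + size B.
Proof. by rewrite (perm_size (perm_msetD A B)) size_cat. Qed.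

Lemma size_mset1 (a : K) : size [mset a] = 1.
Proof. by rewrite enum_msetn. Qed.

Lemma size_mset1D (a : K) A : size (a +` A) = (size A).+1.
Proof. by rewrite size_msetD size_mset1. Qed.

Lemma size_mset2D (a b : K) A : size (a +` (b +` A)) = (size A).+2.
Proof. by rewrite !size_mset1D. Qed.

Lemma mset_mem (a : K) A : a \in A -> exists B, A = a +` B.
Proof. by move=> aA; exists (A `\ a); rewrite msetB1K. Qed.

Lemma mset_neq0_mem A : A <> mset0 -> exists a B, A = a +` B.
Proof.
case: (mset_0Vmem A) => [->//|[a aA] _].
by have [B ->] := mset_mem aA; exists a, B.
Qed.

Lemma mset_size0 A : size A = 0 -> A = mset0.
Proof. by move=> /eqP; rewrite size_mset_eq0 => /eqP. Qed.

Lemma mset_size1 A : size A = 1 -> exists a, A = [mset a].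
Proof.
move=> sA; have [|a [B dA]] := @mset_neq0_mem A.
  by move=> A0; rewrite A0 size_mset0 in sA.
exists a; rewrite dA in sA *; rewrite size_mset1D in sA.
by rewrite (@mset_size0 B) ?msetD0 //; lia.
Qed.

Lemma mset_seq_mset (s : seq K) A : perm_eq s A <-> A = seq_mset s.
Proof.
split=> [/eq_seq_msetP ->|->]; first by rewrite seq_mset_id.
by rewrite perm_sym perm_eq_seq_mset.
Qed.

Lemma mset1DI (a : K) A B : a +` A = a +` B -> A = B.
Proof. by move=> /(congr1 (fun X => X `\ a)); rewrite !msetD1K. Qed.

Lemma msetDI A B C : A `+` B = A `+` C -> B = C.
Proof.
by move=> e; apply/msetP => x; move/msetP/(_ x): e; rewrite !msetE2; lia.
Qed.

Lemma msetD_eq0 A B : A `+` B = mset0 -> A = mset0 /\ B = mset0.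
Proof.
move=> e; have := congr1 (fun X : {mset K} => size X) e.
by rewrite size_msetD size_mset0 => s; split; apply: mset_size0; lia.
Qed.

Lemma msetD1_mem (a : K) A B C : a +` A = B `+` C -> a \in B ->
  exists2 B', B = a +` B' & A = B' `+` C.
Proof.
move=> e /mset_mem[B' dB]; exists B' => //; apply: (@mset1DI a).
by rewrite e dB msetDA.
Qed.

Lemma mset1D_cases (a b : K) A B : a +` A = b +` B ->
  (a = b /\ A = B) \/ exists C, A = b +` C /\ B = a +` C.
Proof.
move=> e; have [ab|/eqP nab] := eqVneq a b.
  by left; split=> //; move: e; rewrite ab => /mset1DI.
right; have : a \in B.
  have : a \in b +` B by rewrite -e mset1D1.
  by rewrite in_mset1D => /orP[/eqP//|].
case/mset_mem=> C dB; exists C; split=> //; apply: (@mset1DI a).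
by rewrite e dB msetDCA.
Qed.

(** P is taken to be the common part of A and C, which forces the rest. *)
Lemma msetD_refine A B C D : A `+` B = C `+` D ->
  exists P Q R T, [/\ A = P `+` Q, B = R `+` T, C = P `+` R & D = Q `+` T].
Proof.
move=> e; exists (A `&` C), (A `\` C), (C `\` A), (B `\` (C `\` A)).
by split; apply/msetP => x; move/msetP/(_ x): e; rewrite !msetE2; lia.
Qed.

Lemma seq_mset_cat (s t : seq K) : seq_mset (s ++ t) = seq_mset s `+` seq_mset t.
Proof. by apply/msetP => x; rewrite msetE2 !mset_seqE count_cat. Qed.

Lemma size_seq_mset (s : seq K) : size (seq_mset s) = size s.
Proof. exact: perm_size (perm_eq_seq_mset s). Qed.

Lemma seq_mset0 : seq_mset [::] = mset0 :> {mset K}.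
Proof. by apply: mset_size0; rewrite size_seq_mset. Qed.

Lemma seq_mset1 (a : K) : seq_mset [:: a] = [mset a].
Proof. by rewrite mset_cons seq_mset0 msetD0. Qed.

Lemma mem_seq_mset (s : seq K) x : (x \in seq_mset s) = (x \in s).
Proof. exact: perm_mem (perm_eq_seq_mset s) x. Qed.

End Multisets.

Section Concat.
Local Open Scope mset_scope.
Variable K : choiceType.
Implicit Types (A B C : {mset K}) (z w : {mset {mset K}}).

Definition concat z : {mset K} := \big[msetD/mset0]_(T <- z) T.

Lemma concat0 : concat mset0 = mset0.
Proof. by rewrite /concat big_mset0. Qed.

Lemma concatD z w : concat (z `+` w) = concat z `+` concat w.
Proof. by rewrite /concat (perm_big _ (perm_msetD z w)) big_cat. Qed.

Lemma concat1 A : concat [mset A] = A.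
Proof. by rewrite /concat enum_msetn big_seq1. Qed.

Lemma concat1D A z : concat (A +` z) = A `+` concat z.
Proof. by rewrite concatD concat1. Qed.

Lemma mem_concat x z : x \in concat z -> exists2 A : {mset K}, A \in z & x \in A.
Proof.
rewrite /concat big_seq; elim/big_ind: _ => [|A B hA hB|A Az xA].
- by rewrite in_mset0.
- by rewrite in_msetD => /orP[].
- by exists A.
Qed.

Lemma mset2_neq0_mem z : z <> mset0 -> exists A w, z = A +` w.
Proof. exact: mset_neq0_mem. Qed.

Lemma mset2_mem A z : A \in z -> exists w, z = A +` w.
Proof. exact: mset_mem. Qed.

End Concat.

(** * Product-one sequences *)

Section ProductOne.
Local Open Scope mset_scope.
Variable gT : finGroupType.
Implicit Types (S T A B : {mset gT}) (g h : gT).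

Lemma po_seqP S :
  product_one S <-> exists2 s, S = seq_mset s & (\prod_(g <- s) g = 1)%g.
Proof. by split=> -[s /mset_seq_mset ? ?]; exists s. Qed.

Lemma po_seq (s : seq gT) : (\prod_(g <- s) g = 1)%g -> product_one (seq_mset s).
Proof. by move=> ps; apply/po_seqP; exists s. Qed.

Lemma po0 : product_one (mset0 : {mset gT}).
Proof. by exists [::]; rewrite ?big_nil ?enum_mset0. Qed.

Lemma poD S T : product_one S -> product_one T -> product_one (S `+` T).
Proof.
case/po_seqP=> s -> ps /po_seqP[t -> pt]; rewrite -seq_mset_cat; apply: po_seq.
by rewrite big_cat /= ps pt mulg1.
Qed.

(** As x y = 1 implies y x = 1, an ordering with product one can be read
    cyclically from any of its terms.  This is what replaces commutativity when
    two product-one sequences are merged. *)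
Lemma prod1_rot (s t : seq gT) :
  (\prod_(g <- s ++ t) g = 1)%g -> (\prod_(g <- t ++ s) g = 1)%g.
Proof.
rewrite !big_cat /= => e.
by apply: (mulgI (\prod_(g <- s) g)%g); rewrite mulgA e mul1g mulg1.
Qed.

Lemma po_rot g T : product_one (g +` T) ->
  exists2 s, T = seq_mset s & (g * \prod_(h <- s) h = 1)%g.
Proof.
case/po_seqP=> s e ps.
have gs : g \in s.
  by rewrite -mem_seq_mset -e mset1D1.
case/splitPr: gs e ps => a b e /prod1_rot; rewrite /= big_cons => pb.
exists (b ++ a) => //. apply: (@mset1DI _ g).
by rewrite e !seq_mset_cat mset_cons msetDCA (msetDC (seq_mset a)).
Qed.

Lemma po_split g h T : product_one ((g * h)%g +` T) ->
  product_one (g +` (h +` T)).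
Proof.
case/po_rot=> s -> ps; rewrite -!mset_cons; apply: po_seq.
by rewrite !big_cons mulgA.
Qed.

(** Starting the first ordering after g and the second one at h makes g and
    h adjacent. *)
Lemma po_join g h A B : product_one (g +` A) -> product_one (h +` B) ->
  product_one ((g * h)%g +` (A `+` B)).
Proof.
case/po_rot=> s -> ps /po_rot[t -> pt].
rewrite (msetDC (seq_mset s)) -seq_mset_cat -mset_cons; apply: po_seq.
by rewrite big_cons big_cat /= mulgA -(mulgA g) pt mulg1.
Qed.

End ProductOne.

(** * Comparing two decompositions of a multiset *)

Section CoarserPartition.
Local Open Scope mset_scope.
Variable K : choiceType.
Implicit Types (A B U V : {mset K}) (z : {mset {mset K}}).

(** A block U of z captures a block V of z' if no other block of z has a term
    in common with V; then U contains V with all multiplicities.  Removing V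
    from both sides either removes U as well, or shrinks U, and then z keeps its
    length while z' gets shorter.  So z is coarser than z', and it is equal to z' as
    soon as it has the same length. *)
Lemma captured_le_size z z' :
    (forall U, U \in z -> U <> mset0) -> (forall V, V \in z' -> V <> mset0) ->
    concat z = concat z' ->
    (forall V, V \in z' -> exists U z0, z = U +` z0 /\
       forall x, x \in V -> x \notin concat z0) ->
  size z <= size z' /\ (size z = size z' -> z = z').
Proof.
have [n] := ubnP (size z'); elim: n z z' => // n IHn z z' ltn z_n0 z'_n0 e capt.
have [z'0|/eqP] := eqVneq z' mset0.
  have [z0|/eqP/mset2_neq0_mem[U [w dz]]] := eqVneq z mset0.
    by rewrite z0 z'0.
  move: e; rewrite dz z'0 concat1D concat0 => /msetD_eq0[U0 _].
  by case: (z_n0 U); rewrite // dz mset1D1.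
case/mset2_neq0_mem=> V [w' dz']; rewrite dz' in e capt z'_n0 ltn *.
have [U [z0 [dz out]]] := capt V (mset1D1 _ _).
rewrite dz !concat1D in e.
have [R dU] : exists R, U = V `+` R.
  exists (U `\` V); rewrite msetBDKC //; apply/msubsetP => x.
  have [/out/mset_eq0P xz0|/mset_eq0P -> //] := boolP (x \in V).
  by move/msetP/(_ x): e; rewrite !msetE2 xz0; lia.
move: e; rewrite dU -msetDA => /msetDI e.
have in_w' W : W \in w' -> W \in V +` w' by move=> Ww'; rewrite in_mset1D Ww' orbT.
rewrite size_mset1D in ltn.
have w'_n0 W : W \in w' -> W <> mset0 by move/in_w'; apply: z'_n0.
have z0_n0 W : W \in z0 -> W <> mset0.
  by move=> Wz0; apply: z_n0; rewrite dz in_mset1D Wz0 orbT.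
have [R0|Rn0] := eqVneq R mset0.
  rewrite R0 mset0D in e.
  have [|les eqs] := IHn z0 w' ltn z0_n0 w'_n0 e.
    move=> W Ww'; have [U' [z1 [dz1 out1]]] := capt W (in_w' _ Ww').
    have : U' \in U +` z0 by rewrite -dz dz1 mset1D1.
    rewrite in_mset1D => /orP[/eqP U'U|/mset2_mem[z2 dz0]].
      (* V uses up all of U, so nothing is left in U for W. *)
      have z10 : z1 = z0 by apply: (@mset1DI _ U); rewrite -dz -U'U -dz1.
      case/mset_neq0_mem: (w'_n0 _ Ww') => x [W1 dW].
      have /out1 : x \in W by rewrite dW mset1D1.
      have [w2 dw] := mset2_mem Ww'.
      by rewrite z10 e dw concat1D in_msetD dW mset1D1.
    exists U', z2; split=> // x /out1; apply: contraNN.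
    suff -> : z1 = U +` z2 by rewrite concat1D in_msetD => ->; rewrite orbT.
    by apply: (@mset1DI _ U'); rewrite -dz1 dz dz0 msetDCA.
  rewrite dz dU R0 msetD0 !size_mset1D; split; first by rewrite ltnS.
  by case=> /eqs ->.
have Rz0_n0 W : W \in R +` z0 -> W <> mset0.
  by rewrite in_mset1D => /orP[/eqP ->|/z0_n0]; first exact/eqP.
clear Rn0.
have [||le _] := IHn (R +` z0) w' ltn Rz0_n0 w'_n0.
- by rewrite concat1D.
- move=> W Ww'; have [U' [z1 [dz1 out1]]] := capt W (in_w' _ Ww').
  have : U' \in U +` z0 by rewrite -dz dz1 mset1D1.
  rewrite in_mset1D => /orP[/eqP U'U|/mset2_mem[z2 dz0]].
    have z10 : z1 = z0 by apply: (@mset1DI _ U); rewrite -dz -U'U -dz1.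
    by exists R, z0; split; [reflexivity|rewrite -z10].
  exists U', (R +` z2); split; first by rewrite dz0 msetDCA.
  have dz1' : z1 = U +` z2.
    by apply: (@mset1DI _ U'); rewrite -dz1 dz dz0 msetDCA.
  move=> x /out1 xz1; move: xz1 => {}/negP xz1; apply/negP => xRz2; apply: xz1.
  move: xRz2; rewrite concat1D in_msetD => xRz2.
  by rewrite dz1' concat1D dU !in_msetD -orbA xRz2 orbT.
- by rewrite size_mset1D in le; rewrite dz !size_mset1D; split; lia.
Qed.

End CoarserPartition.

(** * Atoms and factorizations *)

Section Atoms.
Local Open Scope mset_scope.
Variable gT : finGroupType.
Implicit Types (S T A B U V : {mset gT}) (g h : gT) (z w : {mset {mset gT}}).

Lemma atom_neq0 A : atom A -> A <> mset0. Proof. by case. Qed.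

Lemma atom_po A : atom A -> product_one A. Proof. by case. Qed.

Lemma atom_irr A B : atom (A `+` B) -> product_one A -> product_one B ->
  A = mset0 \/ B = mset0.
Proof. by case=> _ _ irr pA pB; apply: irr. Qed.

Lemma po_one T : product_one (1%g +` T) -> product_one T.
Proof. by case/po_rot=> s ->; rewrite mul1g; apply: po_seq. Qed.

Lemma po_mset1 : product_one [mset (1 : gT)%g].
Proof. by exists [:: 1%g]; rewrite ?big_seq1 // enum_msetn. Qed.

Lemma atom_one A : atom A -> 1%g \in A -> A = [mset 1%g].
Proof.
move=> aA /mset_mem[T dA]; rewrite dA in aA *.
have [e|->] := atom_irr aA po_mset1 (po_one (atom_po aA)); last by rewrite msetD0.
by have := mset11 (1 : gT)%g; rewrite e in_mset0.
Qed.

(** Cutting g h back into g and h would turn a decomposition of the merged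
    sequence into one of the original atom. *)
Lemma atom_merge g h T : atom (g +` (h +` T)) -> product_one ((g * h)%g +` T) ->
  atom ((g * h)%g +` T).
Proof.
move=> aU pM; split=> //; first by move/msetD_eq0=> [/msetP/(_ (g * h)%g)]; rewrite msetnxx mset0E.
have half A B : product_one A -> product_one B -> (g * h)%g +` T = A `+` B ->
    (g * h)%g \in A -> B = mset0.
  move=> pA pB e /(msetD1_mem e)[A' dA dT]; rewrite dA in pA.
  have [|||/msetD_eq0[/msetP/(_ g)]|//] := @atom_irr (g +` (h +` A')) B.
  - by rewrite -!msetDA -dT.
  - exact: (po_split pA).
  - exact: pB.
  - by rewrite msetnxx mset0E.
move=> A B pA pB e.
have : (g * h)%g \in A `+` B by rewrite -e mset1D1.
rewrite in_msetD => /orP[mA|mB]; first by right; apply: (half A B).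
by left; apply: (half B A) => //; rewrite e msetDC.
Qed.

Lemma facP S z : factorizations S z <-> (forall T, T \in z -> atom T) /\ concat z = S.
Proof. by []. Qed.

Lemma fac_atom S z A : factorizations S z -> A \in z -> atom A.
Proof. by case=> aZ _; apply: aZ. Qed.

Lemma fac_concat S z : factorizations S z -> concat z = S.
Proof. by case. Qed.

Lemma facD S T z w : factorizations S z -> factorizations T w ->
  factorizations (S `+` T) (z `+` w).
Proof.
move=> /facP[aZ <-] /facP[aW <-]; apply/facP; split; last by rewrite concatD.
by move=> A; rewrite in_msetD => /orP[/aZ|/aW].
Qed.

Lemma fac1 A : atom A -> factorizations A [mset A].
Proof. by move=> aA; apply/facP; split=> [B|]; rewrite ?concat1 // in_mset1 => /eqP->. Qed.

Lemma fac1D A S z : atom A -> factorizations S z -> factorizations (A `+` S) (A +` z).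
Proof. by move=> aA fz; apply: facD => //; apply: fac1. Qed.

Lemma fac_subl S z w : factorizations S (z `+` w) -> factorizations (concat z) z.
Proof. by move=> /facP[aZ _]; apply/facP; split=> // A Az; apply: aZ; rewrite in_msetD Az. Qed.

Lemma fac_subr S z w : factorizations S (z `+` w) -> factorizations (concat w) w.
Proof. by rewrite msetDC => /fac_subl. Qed.

Lemma fac0 : factorizations (mset0 : {mset gT}) mset0.
Proof. by apply/facP; split=> [A|]; rewrite ?in_mset0 ?concat0. Qed.

Lemma fac_po S z : factorizations S z -> product_one S.
Proof.
move=> /facP[aZ <-]; rewrite /concat big_seq.
elim/big_ind: _ => [|A B|A Az]; [exact: po0|exact: poD|exact/atom_po/aZ].
Qed.

Lemma fac_neq0 S z : factorizations S z -> S <> mset0 -> 0 < size z.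
Proof.
move=> /fac_concat <- Sn0; rewrite lt0n size_mset_eq0.
by apply/eqP => z0; rewrite z0 concat0 in Sn0.
Qed.

Lemma fac_exists S : product_one S -> exists z, factorizations S z.
Proof.
have [n] := ubnP (size S); elim: n S => // n IHn S ltn pS.
have [S0|/eqP Sn0] := eqVneq S mset0; first by exists mset0; rewrite S0; apply: fac0.
have [aS|naS] := pselect (atom S); first by exists [mset S]; apply: fac1.
have [A [B [pA pB dS An0 Bn0]]] : exists A B, [/\ product_one A, product_one B,
    S = A `+` B, A <> mset0 & B <> mset0].
  apply: contra_notP naS => H; split=> // A B pA pB dS.
  have [|/eqP An0] := eqVneq A mset0; first by left.
  have [|/eqP Bn0] := eqVneq B mset0; first by right.
  by case: H; exists A, B.
have sz (X : {mset gT}) : X <> mset0 -> 0 < size X.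
  by move=> /eqP; rewrite -size_mset_eq0 lt0n.
have [sA sB] := (sz _ An0, sz _ Bn0); rewrite dS size_msetD in ltn *.
have [ltA ltB] : size A < n /\ size B < n by clear -ltn sA sB; lia.
have [z fz] := IHn A ltA pA; have [w fw] := IHn B ltB pB.
by exists (z `+` w); apply: facD.
Qed.

(** An atom of z splits off from A, and irreducibility leaves nothing else. *)
Lemma atom_not_concat A z : atom A -> factorizations A z -> z = [mset A].
Proof.
move=> aA fz; have : z <> mset0.
  by move=> z0; have := fac_concat fz; rewrite z0 concat0 => /esym/(atom_neq0 aA).
case/mset2_neq0_mem=> B [w dz]; rewrite dz in fz *.
have aB := fac_atom fz (mset1D1 _ _).
have e := fac_concat fz; rewrite concat1D in e.
rewrite -e in aA.
have [/(atom_neq0 aB)//|w0] := atom_irr aA (atom_po aB) (fac_po (fac_subr fz)).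
rewrite w0 msetD0 in e; rewrite e; suff -> : w = mset0 by rewrite msetD0.
apply/eqP; rewrite -size_mset_eq0 -leqn0 leqNgt; apply/negP => sw.
have /mset2_neq0_mem[C [w1 dw]] : w <> mset0 by move=> w00; rewrite w00 size_mset0 in sw.
move: w0; rewrite dw concat1D => /msetD_eq0[/atom_neq0 []//].
by apply: (fac_atom fz); rewrite dw in_mset1D mset1D1 orbT.
Qed.

(** Partial products of an ordering with product one must be pairwise
    distinct: two equal ones cut out a product-one factor whose complement has
    product one too. *)
Lemma atom_size A : atom A -> size A <= #|gT|.
Proof.
move=> aA; have [s dA ps] := (po_seqP A).1 (atom_po aA); rewrite dA size_seq_mset.
pose p (i : 'I_(size s)) := (\prod_(g <- take i s) g)%g.
suff /leq_card : injective p by rewrite card_ord.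
suff lt_p (i j : 'I_(size s)) : i < j -> p i <> p j.
  move=> i j e; apply/val_inj; case: (ltngtP i j) => [/lt_p//|/lt_p|//].
  by rewrite e.
move=> ltij e; pose b := take (j - i) (drop i s).
have dj : take j s = take i s ++ b by rewrite -takeD subnKC // ltnW.
have pb : (\prod_(g <- b) g = 1)%g.
  apply: (mulgI (p i)); rewrite mulg1 [RHS]e /p dj big_cat //.
have ds : s = take i s ++ b ++ drop j s by rewrite catA -dj cat_take_drop.
have pc : (\prod_(g <- take i s ++ drop j s) g = 1)%g.
  have : (\prod_(g <- take i s ++ b ++ drop j s) g = 1)%g by rewrite -ds.
  by rewrite !big_cat /= pb mul1g.
have sb : size b = j - i.
  by rewrite size_take size_drop; have := ltn_ord j; case: ifP; lia.
have e2 : seq_mset s = seq_mset b `+` seq_mset (take i s ++ drop j s).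
  by rewrite seq_mset_cat msetDCA -!seq_mset_cat -ds.
rewrite dA e2 in aA.
case: (atom_irr aA (po_seq pb) (po_seq pc)) => /(congr1 (fun X : {mset gT} => size X));
  rewrite size_seq_mset size_mset0 ?sb ?size_cat ?size_drop.
  by lia.
by have := ltn_ord j; lia.
Qed.

(** If every pair of neighbours in an ordering of an atom V of z' lies in one
    atom of z, then V is captured by an atom of z; this cannot be the case for
    all V by the size comparison above.  So some neighbours g, h in an atom of
    z' lie in distinct atoms of z. *)
Lemma straddling_pair S z z' :
    factorizations S z -> factorizations S z' -> z <> z' -> size z' <= size z ->
  exists g h T A B z0 z0', [/\ z' = (g +` (h +` T)) +` z0',
    product_one ((g * h)%g +` T) & z = (g +` A) +` ((h +` B) +` z0)].
Proof.
move=> fz fz' nzz' le; pose c := z `&` z'.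
have [x dz] : exists x, z = c `+` x by exists (z `\` c); rewrite msetBDKC ?msubsetIl.
have [x' dz'] : exists x', z' = c `+` x' by exists (z' `\` c); rewrite msetBDKC ?msubsetIr.
have cop A : A \in x -> A \notin x'.
  rewrite !in_mset -eqn0Ngt => xA; move: dz dz'.
  by move=> /msetP/(_ A) + /msetP/(_ A); rewrite !msetE2; lia.
clearbody c; move: le nzz'; rewrite dz dz' !size_msetD leq_add2l => le nxx'.
have nxx : x <> x' by move=> e; rewrite e in nxx'.
suff [g [h [T [A [B [z0 [z0' [-> pM ->]]]]]]]] : exists g h T A B z0 z0',
    [/\ x' = (g +` (h +` T)) +` z0', product_one ((g * h)%g +` T) &
        x = (g +` A) +` ((h +` B) +` z0)].
  exists g, h, T, A, B, (c `+` z0), (c `+` z0'); split=> //.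
    by rewrite msetDCA.
  by rewrite msetDCA; congr (_ `+` _); rewrite msetDCA.
rewrite dz in fz; rewrite dz' in fz'.
have ax A : A \in x -> atom A by move=> Ax; apply: (fac_atom fz); rewrite in_msetD Ax orbT.
have ax' A : A \in x' -> atom A by move=> Ax; apply: (fac_atom fz'); rewrite in_msetD Ax orbT.
have e : concat x = concat x'.
  by apply: (@msetDI _ (concat c)); rewrite -!concatD (fac_concat fz) (fac_concat fz').
apply: contrapT => none.
have stuck V g h T U y y' : x' = V +` y' -> V = g +` (h +` T) ->
    product_one ((g * h)%g +` T) -> x = U +` y ->
    (g \in U -> h \notin concat y) /\ (h \in U -> g \notin concat y).
  move=> dx' dV pM dx; rewrite dV in dx'; split=> /mset_mem[B dU]; apply/negP => /mem_concat[C].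
    case/mset2_mem=> y0 dy /mset_mem[D dC]; case: none.
    exists g, h, T, B, D, y0, y'; split; [exact: dx'|exact: pM|].
    by rewrite dx dU dy dC.
  case/mset2_mem=> y0 dy /mset_mem[D dC]; case: none.
  exists g, h, T, D, B, y0, y'; split; [exact: dx'|exact: pM|].
  by rewrite dx dU dy dC; apply: msetDCA.
have [||//||ge eqs] := @captured_le_size _ x x'.
- by move=> U /ax/atom_neq0.
- by move=> U /ax'/atom_neq0.
- move=> V Vx'; have aV := ax' _ Vx'; have [y' dx'] := mset2_mem Vx'.
  have [s dV ps] := (po_seqP V).1 (atom_po aV).
  have xin g : g \in s -> g \in concat x.
    by move=> gs; rewrite e dx' concat1D in_msetD dV mem_seq_mset gs.
  case: s => [|g [|h s]] in dV ps xin.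
  + by case: (atom_neq0 aV); rewrite dV; apply/mset_size0; rewrite size_seq_mset.
  + rewrite big_seq1 in ps; have [|U Ux gU] := @mem_concat _ g x.
      by apply: xin; rewrite mem_head.
    case/negP: (cop U Ux); rewrite ps in gU dV.
    rewrite (atom_one (ax U Ux) gU) -(atom_one aV) //.
    by rewrite dV mem_seq_mset mem_head.
  have adj p a b q : [:: g, h & s] = p ++ [:: a, b & q] ->
      exists2 T, V = a +` (b +` T) & product_one ((a * b)%g +` T).
    move=> ds; exists (seq_mset (p ++ q)).
      by rewrite dV ds !seq_mset_cat !mset_cons (msetDCA (seq_mset p)) (msetDCA (seq_mset p)).
    have -> : (a * b)%g +` seq_mset (p ++ q) = seq_mset (p ++ (a * b)%g :: q).
      by rewrite !seq_mset_cat mset_cons msetDCA.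
    by apply: po_seq; move: ps; rewrite ds !big_cat /= !big_cons !mulgA.
  have [|U Ux gU] := @mem_concat _ g x; first by apply: xin; rewrite mem_head.
  have [y dx] := mset2_mem Ux; exists U, y; split=> //.
  have tail p a q : [:: g, h & s] = p ++ a :: q -> a \in U ->
      forall b, b \in q -> b \notin concat y.
    elim: q p a => // b q IHq p a ds aU.
    have [T dVT pM] := adj _ _ _ _ ds.
    have bny : b \notin concat y by have [+ _] := stuck V a b T U y y' dx' dVT pM dx; apply.
    have bU : b \in U.
      have := xin b; rewrite ds mem_cat !inE eqxx !orbT => /(_ isT).
      by rewrite dx concat1D in_msetD (negPf bny) orbF.
    move=> t; rewrite inE => /orP[/eqP -> //|tq].
    by apply: (IHq (rcons p a) b) => //; rewrite ds cat_rcons.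
  have gny : g \notin concat y.
    have [T dVT pM] := adj [::] _ _ _ erefl.
    have hny := tail [::] g (h :: s) erefl gU h (mem_head _ _).
    have hU : h \in U.
      have := xin h; rewrite !inE eqxx orbT => /(_ isT).
      by rewrite dx concat1D in_msetD (negPf hny) orbF.
    by have [_ +] := stuck V g h T U y y' dx' dVT pM dx; apply.
  move=> t; rewrite dV mem_seq_mset inE => /orP[/eqP->//|].
  exact: (tail [::] g (h :: s)).
by apply: nxx; apply: eqs; apply/eqP; rewrite eqn_leq le ge.
Qed.

End Atoms.

(** * Merging two terms *)

Section Merging.
Local Open Scope mset_scope.
Variable gT : finGroupType.
Implicit Types (S T Q A B U V X : {mset gT}) (g h : gT).
Implicit Types (x y z w : {mset {mset gT}}).

(** Undoing a merge inside one atom.  This is a relation, since neither the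
    atom of y that contains g h nor the factorization w has to be unique. *)
Definition split_of g h y y' := exists (X : {mset gT}) (y0 w : {mset {mset gT}}),
  [/\ y = ((g * h)%g +` X) +` y0, factorizations (g +` (h +` X)) w & y' = w `+` y0].

Lemma split_exists g h Q y : factorizations ((g * h)%g +` Q) y ->
  exists y', split_of g h y y'.
Proof.
move=> fy; have [|U Uy ghU] := @mem_concat _ (g * h)%g y.
  by rewrite (fac_concat fy) mset1D1.
have [y0 dy] := mset2_mem Uy; have [X dU] := mset_mem ghU.
have pU := atom_po (fac_atom fy Uy).
rewrite dU in pU dy; have [w fw] := fac_exists (po_split pU).
by exists (w `+` y0), X, y0, w.
Qed.

Lemma split_fac g h Q y y' : factorizations ((g * h)%g +` Q) y -> split_of g h y y' ->
  factorizations (g +` (h +` Q)) y'.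
Proof.
move=> fy [X [y0 [w [dy fw ->]]]]; rewrite dy in fy.
have := facD fw (fac_subr fy); have := fac_concat fy.
by rewrite concat1D -msetDA => /mset1DI <-; rewrite !msetDA.
Qed.

(** Merging two neighbours of z' that z separates gives a shorter sequence.
    It keeps the length of z', and of z only the two atoms that contain g and h
    are affected. *)
Lemma merge_separated S z z' :
    factorizations S z -> factorizations S z' -> z <> z' -> size z' <= size z ->
  exists g h Q A B z0 y, [/\ S = g +` (h +` Q),
    factorizations ((g * h)%g +` Q) y /\ size y = size z', split_of g h y z',
    z = (g +` A) +` ((h +` B) +` z0) &
    Q = (A `+` B) `+` concat z0 /\ product_one ((g * h)%g +` (A `+` B))].
Proof.
move=> fz fz' nzz' le.
have [g [h [T [A [B [z0 [z0' [dz' pM dz]]]]]]]] := straddling_pair fz fz' nzz' le.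
exists g, h, ((A `+` B) `+` concat z0), A, B, z0, (((g * h)%g +` T) +` z0').
have dS : S = g +` (h +` (A `+` B `+` concat z0)).
  rewrite -(fac_concat fz) dz !concat1D; apply/msetP => t; rewrite !msetE2; lia.
have aT : atom (g +` (h +` T)) by apply: (fac_atom fz'); rewrite dz' mset1D1.
split=> //.
- split; last by rewrite dz'; apply: etrans (size_mset1D _ _) (esym (size_mset1D _ _)).
  have -> : A `+` B `+` concat z0 = T `+` concat z0'.
    have := fac_concat fz'; rewrite dz' dS concat1D -!msetDA.
    by do 2!move/mset1DI; move=> ->; rewrite !msetDA.
  rewrite msetDA; apply: fac1D; first exact: atom_merge.
  by apply: (@fac_subr _ S [mset (g +` (h +` T))]); rewrite -dz'.
- exists T, z0', [mset (g +` (h +` T))]; split; [reflexivity|exact: fac1|exact: dz'].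
- split; [reflexivity|]; apply: po_join; apply: atom_po; apply: (fac_atom fz);
    by rewrite dz !in_mset1D eqxx ?orbT.
Qed.

Lemma fac_merged g h Q A B z0 S w : factorizations S ((g +` A) +` ((h +` B) +` z0)) ->
    Q = (A `+` B) `+` concat z0 -> factorizations ((g * h)%g +` (A `+` B)) w ->
  factorizations ((g * h)%g +` Q) (w `+` z0).
Proof.
move=> fz -> fw; rewrite msetDA; apply: facD => //.
by apply: (@fac_subr _ S ([mset (g +` A)] `+` [mset (h +` B)])); rewrite -msetDA.
Qed.

(** * Gaps in sets of lengths *)

Definition has_length S k := exists2 z, factorizations S z & size z = k.

(** Only a lower bound for the next length is asked for, because this form passes
    to merged sequences, with e - 1 in place of e. *)
Definition next_length_ge k e S := [/\ has_length S k,
  exists2 l, has_length S l & k < l &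
  forall l, has_length S l -> k < l -> k + e <= l].

Definition next_length k e S := next_length_ge k e S /\ has_length S (k + e).

Hypothesis hP : property_P gT.

(** The lower bound holds because splitting a non-empty sequence leaves it
    non-empty; the upper bound is Property P. *)
Lemma split_size g h Q y y' : factorizations ((g * h)%g +` Q) y -> split_of g h y y' ->
  size y <= size y' <= (size y).+1.
Proof.
move=> fy [X [y0 [w [dy fw ->]]]]; rewrite dy size_mset1D size_msetD.
have aU : atom ((g * h)%g +` X) by apply: (fac_atom fy); rewrite dy mset1D1.
have := hP aU erefl fw; suff : 0 < size w by lia.
apply: (fac_neq0 fw) => /(congr1 (fun Y : {mset gT} => size Y)).
by rewrite size_mset1D size_mset0.
Qed.

(** Splitting changes a length by at most one.  So after merging, the next
    length is at least k + e - 1; if it is larger, the merged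
    sequence is a shorter one to which the argument applies again. *)
Lemma gap_pred k e S : 1 < e -> next_length_ge k e S -> exists S', next_length k e.-1 S'.
Proof.
move=> e1; have [n] := ubnP (size S); elim: n S => // n IHn S ltn gapS.
have [[z' fz' sz'] [l [z fz sz] ltkl] ge] := gapS.
have nz : z <> z' by move=> ezz'; rewrite ezz' in sz; lia.
have le : size z' <= size z by lia.
have [g [h [Q [A [B [z0 [y [dS [fy sy] _ dz [dQ pM]]]]]]]]] := merge_separated fz fz' nz le.
have ge' j : has_length ((g * h)%g +` Q) j -> k < j -> k + e.-1 <= j.
  case=> x fx sx ltkj; have [x' sp] := split_exists fx.
  have := split_size fx sp; have fx' := split_fac fx sp; rewrite -dS in fx'.
  have := ge _ (ex_intro2 _ _ x' fx' erefl); lia.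
have gap' : next_length_ge k e.-1 ((g * h)%g +` Q).
  split=> //; first by exists y; rewrite ?sy.
  have [w fw] := fac_exists pM; rewrite dz in fz.
  exists (size (w `+` z0)).
    by exists (w `+` z0) => //; apply: (fac_merged fz).
  have : 0 < size w.
    apply: (fac_neq0 fw) => /(congr1 (fun Y : {mset gT} => size Y)).
    by rewrite size_mset1D size_mset0.
  have := ge _ (ex_intro2 _ _ _ fz erefl); rewrite dz size_mset2D in sz.
  rewrite size_mset2D size_msetD; lia.
(* Either the next length is exactly k + e - 1, or it is at least k + e. *)
have [hl|nl] := pselect (has_length ((g * h)%g +` Q) (k + e.-1)).
  by exists ((g * h)%g +` Q).
apply: (IHn ((g * h)%g +` Q)).
  by move: ltn; rewrite dS !size_mset1D; lia.
have [h1 h2 h3] := gap'; split=> // j hj ltkj.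
have := h3 j hj ltkj; rewrite leq_eqVlt => /orP[/eqP ej|]; last by lia.
by case: nl; rewrite ej.
Qed.

End Merging.

(** * Chains of factorizations *)

Section Chains.
Local Open Scope mset_scope.
Variable gT : finGroupType.
Implicit Types (S T Q A B U V X : {mset gT}) (g h : gT).
Implicit Types (x y z w : {mset {mset gT}}).

Lemma leq_size_msub (K : choiceType) (A B : {mset K}) :
  (forall a, A a <= B a) -> size A <= size B.
Proof. by move/msubsetP/msetBDKC => <-; rewrite size_msetD leq_addr. Qed.

Lemma fact_dist_sym z z' : fact_dist z z' = fact_dist z' z.
Proof. by rewrite /fact_dist maxnC msetIC. Qed.

Lemma fact_distD w x x' : fact_dist (w `+` x) (w `+` x') <= maxn (size x) (size x').
Proof.
rewrite /fact_dist; set a := size (_ `\` _); set b := size (_ `\` _).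
have la : a <= size x by apply: leq_size_msub => A; rewrite !msetE2; lia.
have lb : b <= size x' by apply: leq_size_msub => A; rewrite !msetE2; lia.
by clearbody a b; lia.
Qed.

(** This compares two ways of undoing a merge in a factorization u1 u2 c: one
    replaces u1 by w1, the other replaces u2 by w2. *)
Lemma fact_dist_swap w1 w2 (u1 u2 c : {mset {mset gT}}) : size u1 = 1 -> size u2 = 1 ->
  fact_dist (w1 `+` (u2 `+` c)) (w2 `+` (u1 `+` c)) <= (maxn (size w1) (size w2)).+1.
Proof.
move=> s1 s2.
have e (a b : {mset {mset gT}}) : a `+` (b `+` c) = c `+` (a `+` b).
  by rewrite msetDA msetDC.
apply: leq_trans (eq_leq (congr2 (@fact_dist gT) (e w1 u2) (e w2 u1))) _.
apply: leq_trans (fact_distD _ _ _) _.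
have := size_msetD w2 u1; have := size_msetD w1 u2; rewrite s1 s2; lia.
Qed.

Lemma fact_dist_le_size z z' : fact_dist z z' <= maxn (size z) (size z').
Proof. by rewrite -[in fact_dist _ _](mset0D z) -[in fact_dist _ _](mset0D z') fact_distD. Qed.

Lemma fact_dist_gcd z z' : exists w x x',
  [/\ z = w `+` x, z' = w `+` x', fact_dist z z' = maxn (size x) (size x') &
      forall A, A \in x -> A \notin x'].
Proof.
exists (z `&` z'), (z `\` (z `&` z')), (z' `\` (z `&` z')).
split; rewrite ?msetBDKC ?msubsetIl ?msubsetIr // => A.
by rewrite !in_mset !msetE2; lia.
Qed.

Lemma size_le_dist z z' : size z <= size z' + fact_dist z z'.
Proof.
have [w [x [x' [-> -> -> _]]]] := fact_dist_gcd z z'.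
by rewrite !size_msetD; lia.
Qed.

Definition connected S n z z' := exists s : seq {mset {mset gT}},
  [/\ forall y, y \in s -> factorizations S y,
      path (fun y y' => fact_dist y y' <= n) z s & last z s = z'].

Definition cat_bound S n := forall z z',
  factorizations S z -> factorizations S z' -> connected S n z z'.

Lemma connected_refl S n z : connected S n z z.
Proof. by exists [::]. Qed.

Lemma connected_step S n z z' : factorizations S z' -> fact_dist z z' <= n ->
  connected S n z z'.
Proof.
move=> fz' d; exists [:: z']; split=> [y||//]; last by rewrite /= d.
by rewrite mem_seq1 => /eqP->.
Qed.

Lemma connected_trans S n y z x : connected S n x y -> connected S n y z ->
  connected S n x z.
Proof.
move=> [s [fs ps ls]] [t [ft pt lt]]; exists (s ++ t); split.
- by move=> u; rewrite mem_cat => /orP[/fs|/ft].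
- by rewrite cat_path ps ls.
- by rewrite last_cat ls.
Qed.

Lemma connected_sym S n z z' : factorizations S z -> connected S n z z' ->
  connected S n z' z.
Proof.
move=> fz [s [fs ps <-]]; elim: s z fz fs ps => [|y s IHs] z fz fs /= => [_|/andP[d ps]].
  exact: connected_refl.
apply: (@connected_trans _ _ y).
  apply: IHs => //; first by apply: fs; rewrite mem_head.
  by move=> u us; apply: fs; rewrite inE us orbT.
by apply: connected_step => //; rewrite fact_dist_sym.
Qed.

Lemma connected_mono S n m z z' : n <= m -> connected S n z z' -> connected S m z z'.
Proof.
move=> le [s [fs ps ls]]; exists s; split=> //; apply: sub_path ps => u v d.
exact: leq_trans d le.
Qed.

Lemma fact_distDr w z z' : fact_dist (z `+` w) (z' `+` w) <= fact_dist z z'.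
Proof.
have [v [x [x' [-> -> -> _]]]] := fact_dist_gcd z z'.
rewrite -!(msetDAC v w); exact: fact_distD.
Qed.

Lemma connectedD S T n z z' w : factorizations T w -> connected S n z z' ->
  connected (S `+` T) n (z `+` w) (z' `+` w).
Proof.
move=> fw [s [fs ps <-]]; exists [seq y `+` w | y <- s]; split.
- by move=> y /mapP[u /fs fu ->]; apply: facD.
- rewrite (@path_map _ _ (fun y => y `+` w)); apply: sub_path ps => u v d /=.
  exact: leq_trans (fact_distDr _ _ _) d.
- by rewrite (last_map (fun y => y `+` w)).
Qed.

Lemma atomic_size z : (forall A, A \in z -> atom A) -> 0 < size z -> 0 < size (concat z).
Proof.
move=> az; rewrite lt0n size_mset_eq0 => /eqP/mset2_neq0_mem[A [w dz]].
rewrite dz concat1D size_msetD.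
have : A \in z by rewrite dz mset1D1.
move/az/atom_neq0/eqP; rewrite -size_mset_eq0; lia.
Qed.

(** Factorizations with a common part are connected as soon as everything
    shorter is: the remaining parts are factorizations of a shorter
    sequence. *)
Lemma common_part_connected S n w x x' :
    (forall T, size T < size S -> cat_bound T n) -> 0 < size w ->
    factorizations S (w `+` x) -> factorizations S (w `+` x') ->
  connected S n (w `+` x) (w `+` x').
Proof.
move=> hS w0 f f'.
have e : concat x' = concat x.
  by apply: (@msetDI _ (concat w)); rewrite -!concatD (fac_concat f) (fac_concat f').
have sw : 0 < size (concat w) by apply: atomic_size => // A; apply: (fac_atom (fac_subl f)).
have dS : S = concat x `+` concat w by rewrite msetDC -concatD (fac_concat f).
rewrite !(msetDC w) dS; apply: connectedD; first exact: (fac_subl f).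
apply: hS; [|exact: (fac_subr f)|by rewrite -e; apply: (fac_subr f')].
by rewrite dS size_msetD -[X in X < _]addn0 ltn_add2l.
Qed.

Lemma not_cat_bound S n : ~ cat_bound S n -> exists z z',
  [/\ factorizations S z, factorizations S z', ~ connected S n z z' & size z' <= size z].
Proof.
move=> nb; apply: contrapT => none; apply: nb => z z' fz fz'.
have [le|le] := leqP (size z') (size z).
  by apply: contrapT => nc; apply: none; exists z, z'.
apply: (connected_sym fz'); apply: contrapT => nc; apply: none.
by exists z', z; split=> //; apply: ltnW.
Qed.

Lemma not_connected_dist S n z z' : factorizations S z' -> ~ connected S n z z' ->
  n < fact_dist z z'.
Proof. by move=> fz' nc; rewrite ltnNge; apply/negP => /(connected_step fz'). Qed.

(** * Consecutive catenary degrees *)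

Lemma split_ofD g h y y' r : split_of g h y y' -> split_of g h (y `+` r) (y' `+` r).
Proof.
move=> [X [y0 [w [-> fw ->]]]]; exists X, (y0 `+` r), w.
by split; [rewrite msetDA|exact: fw|rewrite msetDA].
Qed.

Hypothesis hP : property_P gT.

Lemma split_part g h Q x r : factorizations ((g * h)%g +` Q) (x `+` r) ->
    (g * h)%g \in concat x ->
  exists2 x', split_of g h x x' & size x' <= (size x).+1.
Proof.
move=> f /mset_mem[Q' dQ']; have fx := fac_subl f; rewrite dQ' in fx.
have [x' sp] := split_exists fx; exists x' => //.
by have /andP[] := split_size hP fx sp.
Qed.

Lemma split_atom_size g h X w : atom ((g * h)%g +` X) ->
  factorizations (g +` (h +` X)) w -> size w <= 2.
Proof. by move=> aU; apply: (hP aU erefl). Qed.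

(** Splittings have at most two atoms.  Two splittings of the same atom are thus
    at distance at most 2, and splittings of different atoms at distance at
    most 3. *)
Lemma split_same g h Q n y y1 y2 : 2 < n -> factorizations ((g * h)%g +` Q) y ->
    split_of g h y y1 -> split_of g h y y2 ->
  connected (g +` (h +` Q)) n y1 y2.
Proof.
move=> n3 fy s1 s2; apply: connected_step; first exact: (split_fac fy s2).
apply: leq_trans n3; have [X1 [r1 [w1 [dy1 f1 ->]]]] := s1.
have [X2 [r2 [w2 [dy2 f2 ->]]]] := s2.
have a1 : atom ((g * h)%g +` X1) by apply: (fac_atom fy); rewrite dy1 mset1D1.
have a2 : atom ((g * h)%g +` X2) by apply: (fac_atom fy); rewrite dy2 mset1D1.
have l1 := split_atom_size a1 f1; have l2 := split_atom_size a2 f2.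
rewrite dy1 in dy2; have [[_ <-]|[C [-> ->]]] := mset1D_cases dy2.
  rewrite (msetDC w1) (msetDC w2); apply: leq_trans (fact_distD _ _ _) _.
  by rewrite geq_max (leq_trans l1) ?(leq_trans l2).
apply: leq_trans (fact_dist_swap w1 w2 C (size_mset1 _) (size_mset1 _)) _.
by rewrite ltnS geq_max l1.
Qed.

(** Either the common part of y1 and y2 contains g h, and can be split in the
    same way in both, or the remaining parts contain it, and each of them gains at
    most one atom. *)
Lemma split_step g h Q n y1 y2 y1' y2' : 2 < n.+1 -> 
    factorizations ((g * h)%g +` Q) y1 -> factorizations ((g * h)%g +` Q) y2 ->
    fact_dist y1 y2 <= n -> split_of g h y1 y1' -> split_of g h y2 y2' ->
  connected (g +` (h +` Q)) n.+1 y1' y2'.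
Proof.
move=> n3 f1 f2 d s1 s2.
have [w [x1 [x2 [dy1 dy2 dd _]]]] := fact_dist_gcd y1 y2.
have [l1 l2] : size x1 <= n /\ size x2 <= n.
  by move: d; rewrite dd geq_max => /andP[].
suff [u1 [u2 [t1 t2 du]]] : exists u1 u2,
    [/\ split_of g h y1 u1, split_of g h y2 u2 & fact_dist u1 u2 <= n.+1].
  apply: connected_trans (split_same n3 f1 s1 t1) _.
  apply: connected_trans (split_same n3 f2 t2 s2).
  by apply: connected_step du; apply: (split_fac f2 t2).
have gh1 : (g * h)%g \in concat w `+` concat x1.
  by rewrite -concatD -dy1 (fac_concat f1) mset1D1.
have gh2 : (g * h)%g \in concat w `+` concat x2.
  by rewrite -concatD -dy2 (fac_concat f2) mset1D1.
rewrite dy1 in f1 *; rewrite dy2 in f2 *.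
have [ghw|ghw] := boolP ((g * h)%g \in concat w).
  have [w' sp _] := split_part f1 ghw.
  exists (w' `+` x1), (w' `+` x2); split; [exact: split_ofD|exact: split_ofD|].
  by apply: leq_trans (fact_distD _ _ _) _; rewrite geq_max !leqW.
rewrite in_msetD (negPf ghw) in gh1; rewrite in_msetD (negPf ghw) in gh2.
rewrite (msetDC w) in f1 *; rewrite (msetDC w) in f2 *.
have [x1' sp1 le1] := split_part f1 gh1; have [x2' sp2 le2] := split_part f2 gh2.
exists (x1' `+` w), (x2' `+` w); split; [exact: split_ofD|exact: split_ofD|].
rewrite !(msetDC _ w); apply: leq_trans (fact_distD _ _ _) _.
by rewrite geq_max (leq_trans le1) ?(leq_trans le2).
Qed.

Lemma split_connected g h Q n y1 y2 y1' y2' : 2 < n.+1 ->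
    factorizations ((g * h)%g +` Q) y1 -> connected ((g * h)%g +` Q) n y1 y2 ->
    split_of g h y1 y1' -> split_of g h y2 y2' ->
  connected (g +` (h +` Q)) n.+1 y1' y2'.
Proof.
move=> n3 f1 [s [fs ps <-]]; elim: s y1 y1' f1 fs ps => [|y s IHs] y1 y1' f1 fs /=.
  by move=> _; apply: split_same.
case/andP=> d ps s1 s2.
have fy : factorizations ((g * h)%g +` Q) y by apply: fs; rewrite mem_head.
have [y' sy] := split_exists fy.
apply: connected_trans (split_step n3 f1 fy d s1 sy) _.
by apply: (IHs y) => // u us; apply: fs; rewrite inE us orbT.
Qed.

(** In a shortest sequence of catenary degree above n, factorizations that are not
    connected have no common atom, and one of them, z, is long.  Merging neighbours
    from the other one that z separates leaves an atom of z untouched, so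
    a chain for the merged sequence, once split, would connect the two. *)
Lemma catenary_pred S n : 2 < n -> ~ cat_bound S n ->
  exists S', cat_bound S' n /\ ~ cat_bound S' n.-1.
Proof.
move=> n2; have [m] := ubnP (size S); elim: m S => // m IHm S ltm nb.
have [[T [ltT nbT]]|noT] := pselect (exists T, size T < size S /\ ~ cat_bound T n).
  by apply: (IHm T) => //; lia.
have hS T : size T < size S -> cat_bound T n.
  by move=> lt; apply: contrapT => nbT; apply: noT; exists T.
have [z [z' [fz fz' nc le]]] := not_cat_bound nb.
have ltnz : n < size z.
  have := not_connected_dist fz' nc; have := fact_dist_le_size z z'.
  by clear -le; lia.
have nzz' : z <> z' by move=> ezz'; apply: nc; rewrite ezz'; apply: connected_refl.
have [g [h [Q [A [B [z0 [y [dS [fy _] spy dz [dQ pM]]]]]]]]] := merge_separated fz fz' nzz' le.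
exists ((g * h)%g +` Q); split=> [|bM].
  by apply: hS; rewrite dS size_mset2D size_mset1D.
rewrite dz in fz nc ltnz; rewrite size_mset2D in ltnz.
have [w fw] := fac_exists pM; have fw0 := fac_merged fz dQ fw.
have [w' spw] := split_exists fw; have spw0 := split_ofD z0 spw.
have fw0' := split_fac fw0 spw0; rewrite -dS in fw0'.
case: nc; apply: (@connected_trans _ _ (w' `+` z0)).
  move: fz; rewrite (msetDA [mset _]) (msetDC _ z0) (msetDC w') => fz.
  apply: common_part_connected; [exact: hS| |exact: fz|by rewrite msetDC].
  by clear -ltnz n2; lia.
have n3 : 2 < n.-1.+1 by rewrite (ltn_predK n2).
have := split_connected n3 fw0 (bM _ _ fw0 fy) spw0 spy.
by rewrite -dS (ltn_predK n2).
Qed.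

End Chains.

(** * A uniform bound for the catenary degrees *)

Section Dickson.

Definition increasing (phi : nat -> nat) := forall i j, i < j -> phi i < phi j.

Lemma increasing_step phi : (forall i, phi i < phi i.+1) -> increasing phi.
Proof.
move=> H i j; elim: j => // j IHj; rewrite ltnS leq_eqVlt => /orP[/eqP->//|/IHj lt].
exact: ltn_trans (H j).
Qed.

Lemma increasing_ge phi i : increasing phi -> i <= phi i.
Proof.
by move=> H; elim: i => // i IHi; apply: leq_ltn_trans IHi (H _ _ (ltnSn i)).
Qed.

Lemma tail_argmin (u : nat -> nat) n : exists m, n <= m /\ forall j, n <= j -> u m <= u j.
Proof.
suff H v : forall m, n <= m -> u m < v ->
    exists m, n <= m /\ forall j, n <= j -> u m <= u j.
  exact: (H (u n).+1 n).
elim: v => // v IHv m lenm ltv.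
have [[j [lej ltj]]|min] := pselect (exists j, n <= j /\ u j < u m).
  by apply: (IHv j lej); lia.
exists m; split=> // j lej; rewrite leqNgt; apply/negP => ltj; apply: min.
by exists j.
Qed.

(** Jump again and again to a place where the rest of the sequence attains its
    minimum. *)
Lemma monotone_subsequence (u : nat -> nat) :
  exists2 phi, increasing phi & forall i j, i <= j -> u (phi i) <= u (phi j).
Proof.
have [g gP] := choice (tail_argmin u).
pose phi := fix phi n := if n is m.+1 then g (phi m).+1 else g 0.
have phiS n : phi n.+1 = g (phi n).+1 by [].
have inc : increasing phi.
  by apply: increasing_step => i; rewrite phiS; have [] := gP (phi i).+1.
exists phi => // i j; rewrite leq_eqVlt => /orP[/eqP-> //|/inc lt].
have min k : exists2 a, a <= phi k & forall l, a <= l -> u (phi k) <= u l.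
  case: k => [|k]; first by exists 0 => //; have [] := gP 0.
  by exists (phi k).+1; rewrite phiS; have [] := gP (phi k).+1.
by have [a lea mina] := min i; apply: mina; apply: leq_trans lea (ltnW lt).
Qed.

(** This is Dickson's lemma, the coordinates being those in s. *)
Lemma monotone_subsequence_seq (K : eqType) (s : seq K) (f : nat -> K -> nat) :
  exists2 phi, increasing phi &
    forall k, k \in s -> forall i j, i <= j -> f (phi i) k <= f (phi j) k.
Proof.
elim: s => [|k s [phi incphi mon]]; first by exists id.
have [psi incpsi monk] := monotone_subsequence (fun n => f (phi n) k).
exists (phi \o psi) => [i j lt|k']; first exact/incphi/incpsi.
rewrite inE => /orP[/eqP-> //|k's] i j; rewrite leq_eqVlt => /orP[/eqP->//|lt].
by apply: mon => //; apply/ltnW/incpsi.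
Qed.

End Dickson.

Section UniformBound.
Local Open Scope mset_scope.
Variable gT : finGroupType.
Implicit Types (S T A : {mset gT}) (x y z w : {mset {mset gT}}).

Lemma atoms_finite : exists l : seq {mset gT}, forall A, atom A -> A \in l.
Proof.
exists (flatten [seq [seq seq_mset (tval t) | t <- enum {: k.-tuple gT}] |
  k <- iota 0 #|gT|.+1]) => A aA.
apply/flatten_mapP; exists (size A); first by rewrite mem_iota /= ltnS atom_size.
by apply/mapP; exists (in_tuple A); rewrite ?mem_enum //= seq_mset_id.
Qed.

(** Consider shortest sequences with catenary degree above n, for all n, and
    in each of them a pair of factorizations that are not n-connected.  By Dickson's
    lemma one of the pairs is dominated by a later and longer one.  Exchanging
    first the dominated part and then the difference connects the later
    pair. *)
Lemma cat_bound_uniform : exists n, forall S, @cat_bound gT S n.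
Proof.
apply: contrapT => unb.
have bad n : exists p : {mset {mset gT}} * {mset {mset gT}}, exists S,
    [/\ factorizations S p.1, factorizations S p.2, ~ connected S n p.1 p.2 &
     size p.2 <= size p.1] /\ forall T, size T < size S -> cat_bound T n.
  have [S nbS] : exists S, ~ cat_bound S n.
    by apply: contrapT => H; apply: unb; exists n => S; apply: contrapT => nbS; apply: H; exists S.
  have [m] := ubnP (size S); elim: m S nbS => // m IHm S nbS ltm.
  have [[T [ltT nbT]]|noT] := pselect (exists T, size T < size S /\ ~ cat_bound T n).
    by apply: (IHm T) => //; lia.
  have [z [z' zz']] := not_cat_bound nbS; exists (z, z'), S; split=> // T ltT.
  by apply: contrapT => nbT; apply: noT; exists T.
have [f fP] := choice bad; have [l lP] := atoms_finite.
pose F n (bA : bool * {mset gT}) : nat := if bA.1 then (f n).1 bA.2 else (f n).2 bA.2.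
have [phi inc mon] := monotone_subsequence_seq ([seq (true, A) | A <- l] ++ [seq (false, A) | A <- l]) F.
have [S0 [[fz0 fz0' nc0 le0] _]] := fP (phi 0).
(* This index is large enough to make the later pair different from the one at
   phi 0. *)
pose j := (size (f (phi 0)).1 + size (f (phi 0)).2).+1.
have [S [[fz fz' nc le] hS]] := fP (phi j).
have nonatom z A T : factorizations T z -> A \notin l -> z A = 0.
  move=> fT Al; apply/eqP; rewrite mset_eq0; apply: contraNN Al => Az.
  by apply: lP; apply: (fac_atom fT).
have sub1 A : (f (phi 0)).1 A <= (f (phi j)).1 A.
  have [Al|Al] := boolP (A \in l); last by rewrite (nonatom _ _ _ fz0).
  by apply: (mon (true, A)) => //; rewrite mem_cat map_f.
have sub2 A : (f (phi 0)).2 A <= (f (phi j)).2 A.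
  have [Al|Al] := boolP (A \in l); last by rewrite (nonatom _ _ _ fz0').
  by apply: (mon (false, A)) => //; rewrite mem_cat map_f ?orbT.
have [x dx] : exists x, (f (phi j)).1 = (f (phi 0)).1 `+` x.
  by exists ((f (phi j)).1 `\` (f (phi 0)).1); rewrite msetBDKC //; apply/msubsetP.
have [x' dx'] : exists x', (f (phi j)).2 = (f (phi 0)).2 `+` x'.
  by exists ((f (phi j)).2 `\` (f (phi 0)).2); rewrite msetBDKC //; apply/msubsetP.
have d0 := not_connected_dist fz0' nc0.
have dj := not_connected_dist fz' nc.
have d0' := fact_dist_le_size (f (phi 0)).1 (f (phi 0)).2.
have dj' := fact_dist_le_size (f (phi j)).1 (f (phi j)).2.
have gej : j <= phi j by apply: increasing_ge.
move: (phi j) gej fz fz' nc le hS dx dx' dj dj' {sub1 sub2} => n gej fz fz' nc le hS dx dx' dj dj'.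
rewrite /j in gej.
case: (f n) fz fz' nc le dx dx' dj dj' => z z' /= fz fz' nc le dz dz' dj dj'.
move: (phi 0) fz0 fz0' nc0 le0 d0 d0' gej dz dz' => n0.
case: (f n0) => z0 z0' /= fz0 fz0' nc0 le0 d0 d0' gej dz dz'.
have s0 : 0 < size z0.
  have := leq_trans d0 d0'; rewrite (maxn_idPl le0); exact: leq_ltn_trans.
have s0' : 0 < size z0'.
  apply: (fac_neq0 fz0') => S00; have := atomic_size (fun A => fac_atom fz0 (A := A)) s0.
  by rewrite (fac_concat fz0) S00 size_mset0.
rewrite dz in fz; rewrite dz' in fz'.
have cxx' : concat x = concat x'.
  apply: (@msetDI _ S0); rewrite -{1}(fac_concat fz0) -(fac_concat fz0') -!concatD.
  by rewrite (fac_concat fz) (fac_concat fz').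
have sx : 0 < size x.
  have := leq_trans dj dj'; rewrite (maxn_idPl le) dz size_msetD => ltn.
  rewrite lt0n; apply/eqP => sx0; move: ltn; rewrite sx0 addn0 ltnNge.
  by rewrite (leq_trans _ (ltnW gej)) // leq_addr.
have fmid : factorizations S (z0 `+` x').
  rewrite -(fac_concat fz') concatD; apply: facD (fac_subr fz').
  by rewrite (fac_concat fz0') -(fac_concat fz0); apply: fac_subl fz.
have sx' : 0 < size x'.
  apply: (fac_neq0 (fac_subr fz')); rewrite -cxx' => x0.
  by have := atomic_size (fun A => fac_atom (fac_subr fz) (A := A)) sx; rewrite x0 size_mset0.
apply: nc; rewrite dz dz'; apply: (@connected_trans _ _ _ (z0 `+` x')).
  exact: common_part_connected.
move: fmid fz'; rewrite !(msetDC _ x') => fmid fz'.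
exact: common_part_connected.
Qed.

End UniformBound.

(** * Reordering a product *)

Section Reordering.
Variable gT : finGroupType.
Variable K : {group gT}.
Hypothesis cK : forall k x, k \in K -> commute k x.

Lemma prod_shift (s : seq gT) x : (forall y, y \in s -> [~ y, x]%g \in K) ->
  exists2 k, k \in K & (\prod_(g <- s) g * x = x * \prod_(g <- s) g * k)%g.
Proof.
elim: s => [|y s IHs] sK; first by exists 1%g; rewrite ?group1 // big_nil !mulg1 mul1g.
have [|k kK e] := IHs; first by move=> u us; apply: sK; rewrite inE us orbT.
have yK := sK y (mem_head _ _); exists ([~ y, x] * k)%g; first exact: groupM.
move: (commgC y x) yK; move: [~ y, x]%g => c yxE cK'.
rewrite !big_cons -mulgA e !mulgA yxE; congr (_ * k)%g.
by rewrite -!mulgA; congr (_ * (_ * _))%g; exact: (cK _ cK').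
Qed.

(** For trivial K this is commutativity.  For the commutator subgroup, if
    central, it says that all orderings agree modulo that subgroup. *)
Lemma prod_perm (s t : seq gT) :
    (forall x y, x \in s -> y \in s -> [~ x, y]%g \in K) -> perm_eq s t ->
  exists2 k, k \in K & (\prod_(g <- t) g = \prod_(g <- s) g * k)%g.
Proof.
elim: s t => [|x s IHs] t sK pst.
  have /perm_nilP -> : perm_eq t [::] by rewrite perm_sym.
  by exists 1%g; rewrite ?group1 ?mulg1.
have xt : x \in t by rewrite -(perm_mem pst) mem_head.
case/splitPr: xt pst => a b; rewrite perm_sym perm_catC /= perm_cons perm_catC perm_sym => pst.
have [|k1 k1K e1] := IHs _ _ pst.
  by move=> u v us vs; apply: sK; rewrite inE ?us ?vs orbT.
have [|k2 k2K e2] := @prod_shift a x.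
  move=> u ua; apply: sK; last exact: mem_head.
  by rewrite inE (perm_mem pst) mem_cat ua orbT.
exists (k1 * k2)%g; first exact: groupM.
rewrite big_cat /= in e1; rewrite big_cat !big_cons /= mulgA e2 -!mulgA.
congr (x * _)%g; rewrite (cK _ k2K : k2 * _ = _ * k2)%g.
by rewrite [LHS]mulgA e1 mulgA.
Qed.

End Reordering.

Section Commuting.
Local Open Scope mset_scope.
Variable gT : finGroupType.
Implicit Types (S T A B C D : {mset gT}) (g h : gT) (x y z w : {mset {mset gT}}).

Lemma prod_perm_commute (s t : seq gT) : {in s &, forall u v : gT, commute u v} ->
  perm_eq s t -> (\prod_(g <- t) g = \prod_(g <- s) g)%g.
Proof.
move=> cs pst; have [||k /set1gP-> ->] := @prod_perm _ [1 gT]%G _ s t _ pst.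
- by move=> k u /set1gP->; exact/commute_sym/commute1.
- by move=> u v us vs; rewrite inE; apply/commgP/cs.
- by rewrite mulg1.
Qed.

(** * Small atoms *)

Lemma po_size1 S : product_one S -> size S = 1 -> S = [mset 1%g].
Proof.
move=> [s ps p1] sS; move: ps p1; have [a ->] := mset_size1 sS.
move=> ps; have : perm_eq s [:: a] by rewrite (perm_trans ps) // enum_msetn.
by move/perm_small_eq => -> //; rewrite big_seq1 => ->.
Qed.

Lemma po_pair (a b : gT) : product_one (a +` [mset b]) -> (a * b = 1)%g.
Proof.
case/po_rot=> s e p; have : perm_eq s [:: b].
  by apply/eq_seq_msetP; rewrite -e seq_mset1.
by move/perm_small_eq => ds; rewrite ds ?big_seq1 in p.
Qed.

Lemma po_size_ge2 S : product_one S -> S <> mset0 -> 1%g \notin S -> 1 < size S.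
Proof.
move=> pS /eqP; rewrite -size_mset_eq0 => S0 S1.
suff : size S != 1 by lia.
by apply: contraNneq S1 => /(po_size1 pS) ->; rewrite mset11.
Qed.

Lemma atom_size_ge2 A : atom A -> 1%g \notin A -> 1 < size A.
Proof. by move=> aA; apply: po_size_ge2; [exact: atom_po|exact: atom_neq0]. Qed.

(** Two proper product-one parts without the identity would have at least two
    terms each. *)
Lemma atom_small S : product_one S -> S <> mset0 -> 1%g \notin S -> size S <= 3 -> atom S.
Proof.
move=> pS S0 S1 s3; split=> // A B pA pB dS; rewrite dS in_msetD negb_or in S1.
rewrite dS size_msetD in s3; have /andP[A1 B1] := S1.
have [|/eqP A0] := eqVneq A mset0; first by left.
have [|/eqP B0] := eqVneq B mset0; first by right.
by have := po_size_ge2 pA A0 A1; have := po_size_ge2 pB B0 B1; lia.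
Qed.

Lemma atom_notin1 A : atom A -> 1 < size A -> 1%g \notin A.
Proof. by move=> aA sA; apply/negP => /(atom_one aA) dA; rewrite dA size_mset1 in sA. Qed.

Lemma leq_size_concat m z : (forall A, A \in z -> m <= size A) -> m * size z <= size (concat z).
Proof.
have [n] := ubnP (size z); elim: n z => // n IHn z ltn hz.
have [->|/eqP/mset2_neq0_mem[A [w dz]]] := eqVneq z mset0; first by rewrite size_mset0 muln0.
rewrite dz in ltn hz *; rewrite size_mset1D in ltn *; rewrite concat1D size_msetD mulnS.
apply: leq_add; first by apply: hz; rewrite mset1D1.
by apply: IHn => // B Bw; apply: hz; rewrite in_mset1D Bw orbT.
Qed.

Lemma fac_size_half S z : factorizations S z -> 1%g \notin S -> 2 * size z <= size S.
Proof.
move=> fz S1; rewrite -(fac_concat fz); apply: leq_size_concat => A Az.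
apply: atom_size_ge2; first exact: fac_atom fz Az.
apply: contraNN S1 => A1; have [w dz] := mset2_mem Az.
by rewrite -(fac_concat fz) dz concat1D in_msetD A1.
Qed.

(** The commutator relation, with g h^-1 g^-1 as a single last term.  A proper
    product-one part containing g could only be g, g^-1, and then h
    and the last term would be inverse to each other, which is commutation. *)
Lemma noncommuting_atom g h : ~ commute g h ->
  exists2 A : {mset gT}, atom A & size A = 4.
Proof.
move=> ngh; pose k := (g * h^-1 * g^-1)%g.
pose A := g +` (h +` (g^-1 +` [mset k]))%g.
have pA : product_one A.
  exists [:: g; h; g^-1; k]%g; first by apply/mset_seq_mset; rewrite !mset_cons seq_mset0 msetD0.
  by rewrite !big_cons big_nil /k mulg1 !mulgA mulgKV mulgK mulgV.
have A1 : 1%g \notin A.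
  rewrite !in_mset1D in_mset1 ![1%g == _]eq_sym; apply/negP => /or4P[] /eqP e; apply: ngh.
  - by rewrite e; exact/commute_sym/commute1.
  - by rewrite e; exact/commute1.
  - by rewrite -(invgK g) e invg1; exact/commute_sym/commute1.
  - have -> : h = 1%g; last exact: commute1.
    by apply: invg_inj; apply: (mulgI g); apply: (mulIg g^-1%g); rewrite [LHS]e invg1 mulg1 mulgV.
have sA : size A = 4 by rewrite !size_mset1D size_mset1.
exists A => //; split=> //; first by move=> A0; rewrite A0 size_mset0 in sA.
suff half T U : product_one T -> product_one U -> A = T `+` U -> g \in T -> U = mset0.
  move=> T U pT pU e; have : g \in T `+` U by rewrite -e mset1D1.
  rewrite in_msetD => /orP[gT'|gU]; first by right; apply: (half T U).
  by left; apply: (half U T) => //; rewrite e msetDC.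
move=> pT pU e gT'; have := A1; rewrite e in_msetD negb_or => /andP[T1 U1].
have [//|/eqP U0] := eqVneq U mset0.
have sU := po_size_ge2 pU U0 U1.
have T0 : T <> mset0 by move=> T0; rewrite T0 in_mset0 in gT'.
have sT := po_size_ge2 pT T0 T1.
have [T' dT] := mset_mem gT'; rewrite dT size_mset1D in sT.
have [|b dT'] := @mset_size1 _ T'.
  by move: sA; rewrite e dT size_msetD size_mset1D; lia.
rewrite dT dT' in pT e; have gb := po_pair pT.
have {}gb : b = g^-1%g by apply: (mulgI g); rewrite gb mulgV.
case: ngh; move: e; rewrite gb /A -msetDA => /mset1DI.
rewrite msetDCA => /mset1DI e; rewrite -e in pU.
have := po_pair pU; rewrite /k !mulgA => hk.
by apply: (mulIg h^-1%g); apply: (mulIg g^-1%g); rewrite mulgK mulgV -hk.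
Qed.

End Commuting.

(** * Small catenary degrees *)

Section SmallDegrees.
Local Open Scope mset_scope.
Variable gT : finGroupType.
Implicit Types (S T A B C D P Q R : {mset gT}) (g h : gT) (x y z w : {mset {mset gT}}).

(** A factorization with at most one atom factors the empty sequence or an
    atom. *)
Lemma fac_unique_small S x x' : factorizations S x -> factorizations S x' ->
  size x <= 1 -> x = x'.
Proof.
move=> fx fx'; rewrite leq_eqVlt ltnS leqn0 => /orP[/eqP/mset_size1[A dx]|].
  rewrite dx in fx *; have eS := fac_concat fx; rewrite concat1 in eS.
  rewrite -eS in fx'; symmetry; apply: atom_not_concat fx'.
  by apply: (fac_atom fx); rewrite mset11.
rewrite size_mset_eq0 => /eqP x0; rewrite x0 in fx *; apply/esym/mset_size0.
have eS := fac_concat fx; rewrite concat0 in eS.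
apply/eqP; rewrite -leqn0 leqNgt; apply/negP => s0.
by have := atomic_size (fun A => fac_atom fx' (A := A)) s0; rewrite (fac_concat fx') -eS size_mset0.
Qed.

(** Cancelling the greatest common divisor leaves factorizations of one
    sequence without a common atom; neither of them can have fewer than two atoms. *)
Lemma distinct_factorizations S z z' : factorizations S z -> factorizations S z' ->
    z <> z' -> exists w x x' T, [/\ z = w `+` x /\ z' = w `+` x',
      factorizations T x /\ factorizations T x', 1 < size x <= fact_dist z z',
      1 < size x' <= fact_dist z z' & forall A, A \in x -> A \notin x'].
Proof.
move=> fz fz' nzz'; have [w [x [x' [dz dz' dd dis]]]] := fact_dist_gcd z z'.
exists w, x, x', (concat x).
have nxx' : x <> x' by move=> e; apply: nzz'; rewrite dz dz' e.
rewrite dd leq_maxl leq_maxr !andbT; rewrite dz in fz; rewrite dz' in fz'.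
have fx := fac_subr fz; have fx' : factorizations (concat x) x'.
  suff -> : concat x = concat x' by apply: fac_subr fz'.
  by apply: (@msetDI _ (concat w)); rewrite -!concatD (fac_concat fz) (fac_concat fz').
split=> //; rewrite ltnNge; apply/negP => le; apply: nxx'.
  exact: (fac_unique_small fx fx' le).
exact: (esym (fac_unique_small fx' fx le)).
Qed.

Lemma dist_le1_eq S z z' : factorizations S z -> factorizations S z' ->
  fact_dist z z' <= 1 -> z = z'.
Proof.
move=> fz fz' d; apply: contrapT => n.
by have [w [x [x' [T [_ _ s1 _ _]]]]] := distinct_factorizations fz fz' n; lia.
Qed.

Lemma dist_le2_size S z z' : factorizations S z -> factorizations S z' ->
  fact_dist z z' <= 2 -> size z = size z'.
Proof.
move=> fz fz' d; have [-> //|/eqP n] := eqVneq z z'.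
have [w [x [x' [T [[dz dz'] _ /andP[l1 l2] /andP[l3 l4] _]]]]] := distinct_factorizations fz fz' n.
have sx : size x = 2 by apply/eqP; rewrite eqn_leq l1 (leq_trans l2 d).
have sx' : size x' = 2 by apply/eqP; rewrite eqn_leq l3 (leq_trans l4 d).
by rewrite dz dz' !size_msetD sx sx'.
Qed.

Lemma connected_inv (R : {mset {mset gT}} -> {mset {mset gT}} -> Prop) S n z z' :
    (forall x, R x x) -> (forall y x z, R x y -> R y z -> R x z) ->
    (forall y y', factorizations S y -> factorizations S y' -> fact_dist y y' <= n -> R y y') ->
    factorizations S z -> connected S n z z' -> R z z'.
Proof.
move=> Rxx Rtr Rd fz [s [fs ps <-]]; elim: s z fz fs ps => [|y s IHs] z fz fs //=.
case/andP=> d ps; have fy : factorizations S y by apply: fs; rewrite mem_head.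
apply: (Rtr y); first exact: Rd.
by apply: IHs => // u us; apply: fs; rewrite inE us orbT.
Qed.

Lemma not_cat_bound1 S z z' : factorizations S z -> factorizations S z' -> z <> z' ->
  ~ cat_bound S 1.
Proof.
move=> fz fz' n b; apply: n; apply: (@connected_inv eq S 1) (b _ _ fz fz') => //.
  by move=> y x u -> ->.
exact: dist_le1_eq.
Qed.

(** Chains with steps of size at most 2 do not change the length. *)
Lemma not_cat_bound2 S z z' : factorizations S z -> factorizations S z' ->
  size z <> size z' -> ~ cat_bound S 2.
Proof.
move=> fz fz' n b; apply: n.
apply: (@connected_inv (fun y y' => size y = size y') S 2) (b _ _ fz fz') => //.
  by move=> y x u -> ->.
exact: dist_le2_size.
Qed.

Lemma cat_bound_size S n : (forall z, factorizations S z -> size z <= n) -> cat_bound S n.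
Proof.
move=> H z z' fz fz'; apply: connected_step => //.
by apply: leq_trans (fact_dist_le_size _ _) _; rewrite geq_max !H.
Qed.

(** The product of g, h, (gh)^-1 with g^-1, h^-1, gh is also the product of
    the three pairs of mutually inverse terms. *)
Lemma lengths_2_3 : 2 < #|gT| -> exists S, [/\ has_length S 2, has_length S 3 & cat_bound S 3].
Proof.
move=> G3; have [g g1] : exists g : gT, g != 1%g.
  apply/existsP; apply: contraLR G3; rewrite negb_exists => /forallP H.
  rewrite -leqNgt; apply: leq_trans (_ : size [:: 1%g : gT] <= 2) => //.
  apply: leq_trans (card_size _).
  by apply: subset_leq_card; apply/fintype.subsetP => u _; have := H u; rewrite negbK inE.
have [h] : exists h : gT, h \notin [:: 1; g^-1]%g.
  apply/existsP; apply: contraLR G3; rewrite negb_exists => /forallP H.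
  rewrite -leqNgt; apply: leq_trans (card_size [:: 1; g^-1]%g).
  by apply: subset_leq_card; apply/fintype.subsetP => u _; have := H u; rewrite negbK.
rewrite !inE negb_or => /andP[h1 hg].
have gh1 : (g * h != 1)%g by apply: contraNneq hg => e; apply/eqP/(mulgI g); rewrite e mulgV.
pose k := (g * h)%g.
have inv_n1 (u : gT) : u != 1%g -> u^-1%g != 1%g by rewrite invg_eq1.
have atomseq (s : seq gT) : (\prod_(u <- s) u = 1)%g -> 0 < size s <= 3 ->
    1%g \notin s -> atom (seq_mset s).
  move=> ps /andP[s0 s3] s1; apply: atom_small; rewrite ?size_seq_mset ?mem_seq_mset //.
    exact: po_seq.
  by move=> e; rewrite -size_seq_mset e size_mset0 in s0.
pose s1 := [:: g; h; k^-1]%g; pose s2 := [:: h^-1; g^-1; k]%g.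
have n1 (s : seq gT) : all (fun u => u != 1%g) s -> 1%g \notin s.
  by move/allP => H; apply/negP => /H; rewrite eqxx.
have a1 : atom (seq_mset s1).
  by apply: atomseq; rewrite ?n1 //= ?g1 ?h1 ?inv_n1 // !big_cons big_nil mulg1 mulgA mulgV.
have a2 : atom (seq_mset s2).
  by apply: atomseq; rewrite ?n1 //= ?inv_n1 ?gh1 // !big_cons big_nil mulg1 mulgA -invMg mulVg.
have apair (u : gT) : u != 1%g -> atom (seq_mset [:: u; u^-1]%g).
  move=> u1; apply: atomseq; rewrite ?n1 //= ?u1 ?inv_n1 //.
  by rewrite !big_cons big_nil mulg1 mulgV.
have f1 := fac1D a1 (fac1 a2).
have f2 := fac1D (apair g g1) (fac1D (apair h h1) (fac1 (apair k gh1))).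
have e : seq_mset s1 `+` seq_mset s2 =
    seq_mset [:: g; g^-1]%g `+` (seq_mset [:: h; h^-1]%g `+` seq_mset [:: k; k^-1]%g).
  have ac (a b c a' b' c' : {mset gT}) : (a `+` (b `+` c)) `+` (b' `+` (a' `+` c')) =
      (a `+` a') `+` ((b `+` b') `+` (c' `+` c)).
    by apply/msetP => u; rewrite !msetE2; lia.
  by rewrite /s1 /s2 !mset_cons seq_mset0 !msetD0; apply: ac.
exists (seq_mset s1 `+` seq_mset s2); split.
- by exists ([mset (seq_mset s1); seq_mset s2]) => //; rewrite size_mset1D size_mset1.
- rewrite e; exists (seq_mset [:: g; g^-1]%g +` (seq_mset [:: h; h^-1]%g +` [mset (seq_mset [:: k; k^-1]%g)])) => //.
  by rewrite size_mset2D size_mset1.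
- apply: cat_bound_size => z fz.
  have := fac_size_half fz; rewrite size_msetD !size_seq_mset /= in_msetD !mem_seq_mset negb_or.
  rewrite !n1 /= ?inv_n1 ?g1 ?h1 ?gh1 // => /(_ isT).
  by clear; lia.
Qed.

(** Merging neighbours shortens an atom by one term. *)
Lemma atom_of_size4 A : atom A -> 3 < size A ->
  exists g1 g2 g3 g4 : gT, atom (seq_mset [:: g1; g2; g3; g4]) /\ (g1 * g2 * (g3 * g4) = 1)%g.
Proof.
move=> aA sA; have [s dA ps] := (po_seqP A).1 (atom_po aA).
rewrite dA size_seq_mset in aA sA; have [n sn] : exists n, size s = n by exists (size s).
rewrite sn in sA; elim: n => // n IHn in s sn sA ps aA {dA} *.
case: s sn ps aA => [|g1 [|g2 [|g3 [|g4 s]]]] //= [sn] ps aA; try by rewrite -sn in sA.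
case: s sn ps aA => [|g5 s] sn ps aA.
  by exists g1, g2, g3, g4; split=> //; rewrite -ps !big_cons big_nil mulg1 !mulgA.
have ps' : (\prod_(g <- [:: g1 * g2, g3, g4, g5 & s]) g = 1)%g.
  by move: ps; rewrite !big_cons !mulgA.
apply: (IHn [:: (g1 * g2)%g, g3, g4, g5 & s]) => //; first by rewrite -sn.
move: aA; rewrite !(mset_cons g1) !(mset_cons g2) (mset_cons (g1 * g2)%g) => aA.
by apply: atom_merge aA _; rewrite -mset_cons; apply: po_seq.
Qed.

(** With x = g1 g2 and y = g3 g4, the sequence g1 g2 g3 g4 x y has the two
    factorizations (g1 g2 g3 g4)(x y) and (g1 g2 y)(x g3 g4), and none
    with three atoms. *)
Lemma catenary_degree_2 A : atom A -> 3 < size A ->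
  exists S, cat_bound S 2 /\ ~ cat_bound S 1.
Proof.
move=> aA sA; have [g1 [g2 [g3 [g4 [aU pxy]]]]] := atom_of_size4 aA sA.
pose x := (g1 * g2)%g; pose y := (g3 * g4)%g.
pose U := seq_mset [:: g1; g2; g3; g4].
have U1 : 1%g \notin U by apply: atom_notin1 => //; rewrite size_seq_mset.
have : 1%g \notin [:: g1; g2; g3; g4] by rewrite -mem_seq_mset.
rewrite !inE !(eq_sym 1%g) !negb_or => /and4P[n1 n2 n3 n4].
have dU : U = seq_mset [:: g1; g2] `+` seq_mset [:: g3; g4] by rewrite -seq_mset_cat.
have nx : x != 1%g.
  apply/eqP => x1; have y1 : y = 1%g by rewrite -pxy -/x x1 mul1g.
  have p1 : product_one (seq_mset [:: g1; g2]).
    by apply: po_seq; rewrite !big_cons big_nil mulg1.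
  have p2 : product_one (seq_mset [:: g3; g4]).
    by apply: po_seq; rewrite !big_cons big_nil mulg1.
  rewrite -/U dU in aU.
  by case: (atom_irr aU p1 p2) => /(congr1 (fun X : {mset gT} => size X)); rewrite size_seq_mset size_mset0.
have ny : y != 1%g by apply: contraNneq nx => y1; rewrite -pxy -/y y1 mulg1.
have atomseq (s : seq gT) : (\prod_(u <- s) u = 1)%g -> 0 < size s <= 3 ->
    all (fun u => u != 1%g) s -> atom (seq_mset s).
  move=> ps /andP[s0 s3] s1; apply: atom_small; rewrite ?size_seq_mset ?mem_seq_mset //.
  - exact: po_seq.
  - by move=> e; rewrite -size_seq_mset e size_mset0 in s0.
  - by apply/negP => /(allP s1); rewrite eqxx.
pose V := seq_mset [:: x; y]; pose W1 := seq_mset [:: g1; g2; y]; pose W2 := seq_mset [:: x; g3; g4].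
have aV : atom V by apply: atomseq; rewrite //= ?nx ?ny // !big_cons big_nil mulg1.
have aW1 : atom W1.
  by apply: atomseq; rewrite //= ?n1 ?n2 ?ny // !big_cons big_nil mulg1 mulgA.
have aW2 : atom W2.
  by apply: atomseq; rewrite //= ?n3 ?n4 ?nx // !big_cons big_nil mulg1.
have fUV := fac1D aU (fac1 aV); rewrite -/U in fUV.
have fW := fac1D aW1 (fac1 aW2).
have e : U `+` V = W1 `+` W2.
  have ac (a b c d u v : {mset gT}) : (a `+` (b `+` (c `+` d))) `+` (u `+` v) =
      (a `+` (b `+` v)) `+` (u `+` (c `+` d)).
    by apply/msetP => t; rewrite !msetE2; lia.
  by rewrite /U /V /W1 /W2 !mset_cons seq_mset0 !msetD0; apply: ac.
exists (U `+` V); split; last first.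
  rewrite -e in fW; apply: (not_cat_bound1 fUV fW) => ez.
  have : U \in W1 +` [mset W2] by rewrite -ez mset1D1.
  rewrite in_mset1D in_mset1 => /orP[]/eqP/(congr1 (fun X : {mset gT} => size X));
    by rewrite !size_seq_mset.
have V1 : 1%g \notin V by rewrite mem_seq_mset !inE !(eq_sym 1%g) negb_or nx.
have S1 : 1%g \notin U `+` V by rewrite in_msetD negb_or U1.
apply: cat_bound_size => z fz; rewrite leqNgt; apply/negP => z3.
have xz : x \in concat z by rewrite (fac_concat fz) in_msetD !mem_seq_mset mem_head orbT.
have [B Bz xB] := mem_concat xz; have [z1 dz] := mset2_mem Bz.
have aB := fac_atom fz Bz; have [B' dB] := mset_mem xB.
rewrite dz in fz z3; rewrite size_mset1D ltnS in z3.
have eS := fac_concat fz; rewrite concat1D in eS.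
have c1 : 1%g \notin concat z1 by move: S1; rewrite -eS in_msetD negb_or => /andP[].
have B1 : 1%g \notin B by move: S1; rewrite -eS in_msetD negb_or => /andP[].
have fz1 : factorizations (concat z1) z1 by apply: (@fac_subr _ _ [mset B]); exact: fz.
have h1 := fac_size_half fz1 c1; have h2 := atom_size_ge2 aB B1.
have := congr1 (fun X : {mset gT} => size X) eS.
have [sU sV] : size U = 4 /\ size V = 2 by rewrite !size_seq_mset.
rewrite !size_msetD sU sV => sS.
(* The other atoms, at least two of them, have at least four of the six terms. *)
have sB : size B = 2 by move: h1 h2 z3 sS; clear; move: (size B) (size (concat z1)) (size z1); lia.
have [|b dB'] := @mset_size1 _ B'.
  by apply: succn_inj; rewrite -(size_mset1D x) -dB.
have eB : B = V.
  have := atom_po aB; rewrite dB dB' => /po_pair xb.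
  have -> : b = y by apply: (mulgI x); rewrite xb.
  by rewrite /V mset_cons seq_mset1.
rewrite eB msetDC in eS; have cz1 : concat z1 = U.
  by apply: (@msetDI _ V); rewrite msetDC eS msetDC.
rewrite cz1 in fz1; have := atom_not_concat aU fz1.
by move=> z1U; rewrite z1U size_mset1 in z3.
Qed.

(** * Groups with large Davenport constant 3 *)

Lemma short_atoms_commute : (forall A : {mset gT}, atom A -> size A <= 3) ->
  forall g h : gT, commute g h.
Proof.
move=> H g h; apply: contrapT => /noncommuting_atom[A aA sA].
by have := H A aA; rewrite sA.
Qed.

Lemma abelian_po S (s : seq gT) : (forall g h : gT, commute g h) -> S = seq_mset s ->
  product_one S -> (\prod_(g <- s) g = 1)%g.
Proof.
move=> ab dS /po_seqP[t dt pt]; apply: etrans pt; apply: prod_perm_commute; first by move=> u v _ _; apply: ab.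
by apply/eq_seq_msetP; rewrite -dt dS.
Qed.

Lemma abelian_po_cancel A B : (forall g h : gT, commute g h) -> product_one A ->
  product_one (A `+` B) -> product_one B.
Proof.
move=> ab /po_seqP[s dA ps] pAB; apply/po_seqP; exists B; first by rewrite seq_mset_id.
have := @abelian_po (A `+` B) (s ++ B) ab _ pAB.
by rewrite big_cat /= ps mul1g; apply; rewrite seq_mset_cat -dA seq_mset_id.
Qed.

Lemma abelian_atom_cancel A B : (forall g h : gT, commute g h) -> atom A ->
  atom (A `+` B) -> B = mset0.
Proof.
move=> ab aA aAB; have pB := abelian_po_cancel ab (atom_po aA) (atom_po aAB).
by case: (atom_irr aAB (atom_po aA) pB) => // /(atom_neq0 aA).
Qed.

Lemma abelian_single a b Q : (forall g h : gT, commute g h) ->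
  product_one (a +` Q) -> product_one (b +` Q) -> a = b.
Proof.
move=> ab pa pb.
have dQ u : u +` Q = seq_mset (u :: Q) by rewrite mset_cons seq_mset_id.
have := etrans (abelian_po ab (dQ a) pa) (esym (abelian_po ab (dQ b) pb)).
rewrite !big_cons.
exact: mulIg.
Qed.

(** Refine A + B = C + D.  If no part of the refinement is empty then two
    opposite parts are single terms, which have to be equal, as they complete the
    same part to product one. *)
Lemma short_atoms_pairs A B C D : (forall A : {mset gT}, atom A -> size A <= 3) ->
  atom A -> atom B -> atom C -> atom D -> A `+` B = C `+` D -> A = C \/ A = D.
Proof.
move=> H aA aB aC aD /msetD_refine[P [Q [R [T [dA dB dC dD]]]]].
have ab := short_atoms_commute H.
have := H _ aA; have := H _ aB; have := H _ aC; have := H _ aD.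
rewrite dA dB dC dD in aA aB aC aD *; rewrite !size_msetD => sD sC sB sA.
have zero (X : {mset gT}) : size X = 0 -> X = mset0 by apply: mset_size0.
have [/zero P0|P1] := posnP (size P).
  rewrite P0 mset0D in aA aC *; right.
  by rewrite (abelian_atom_cancel ab aA aD) msetD0.
have [/zero Q0|Q1] := posnP (size Q).
  rewrite Q0 msetD0 in aA *; left.
  by rewrite (abelian_atom_cancel ab aA aC) msetD0.
have [/zero R0|R1] := posnP (size R).
  rewrite R0 msetD0 in aC *; left.
  by rewrite (abelian_atom_cancel ab aC aA) msetD0.
have [/zero T0|T1] := posnP (size T).
  rewrite T0 msetD0 in aD *; right.
  by rewrite msetDC in aA *; rewrite (abelian_atom_cancel ab aD aA) msetD0.
have [[/mset_size1[p dP] /mset_size1[t dT]]|[/mset_size1[q dQ] /mset_size1[r dR]]] :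
    (size P = 1 /\ size T = 1) \/ (size Q = 1 /\ size R = 1) by lia.
  rewrite dP dT in aA aD *; right; rewrite (msetDC Q) in aD *.
  by rewrite (abelian_single ab (atom_po aA) (atom_po aD)).
rewrite dQ dR !(msetDC P) in aA aC *; left.
by rewrite (abelian_single ab (atom_po aA) (atom_po aC)).
Qed.

(** A step of size 2 exchanges two atoms for two others, so with short atoms it
    is no step at all. *)
Lemma short_atoms_degree S : (forall A : {mset gT}, atom A -> size A <= 3) ->
  cat_bound S 2 -> cat_bound S 1.
Proof.
move=> H b z z' fz fz'; suff -> : z = z' by apply: connected_refl.
apply: (@connected_inv eq S 2) (b _ _ fz fz') => //; first by move=> y x u -> ->.
move=> y y' fy fy' d; apply: contrapT => n.
have [w [x [x' [T [_ [fx fx'] /andP[l1 l2] /andP[l3 l4] dis]]]]] := distinct_factorizations fy fy' n.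
have two u : factorizations T u -> size u = 2 -> exists A B,
    [/\ u = A +` [mset B], atom A, atom B & A `+` B = T].
  move=> fu su; have [|A [v du]] := @mset2_neq0_mem _ u.
    by move=> u0; rewrite u0 size_mset0 in su.
  have [|B dv] := @mset_size1 _ v; first by rewrite du size_mset1D in su; lia.
  rewrite dv in du; exists A, B; split=> //; try (apply: (fac_atom fu); rewrite du in_mset1D).
  - by rewrite eqxx.
  - by rewrite mset11 orbT.
  - by rewrite -(fac_concat fu) du concat1D concat1.
have sx : size x = 2 by apply/eqP; rewrite eqn_leq l1 (leq_trans l2 d).
have sx' : size x' = 2 by apply/eqP; rewrite eqn_leq l3 (leq_trans l4 d).
have [A [B [dx aA aB eT]]] := two x fx sx.
have [C [D [dx' aC aD eT']]] := two x' fx' sx'.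
have Ax : A \in x by rewrite dx mset1D1.
have := dis A Ax; rewrite dx' in_mset1D in_mset1.
by have [->|->] := short_atoms_pairs H aA aB aC aD (etrans eT (esym eT')); rewrite eqxx ?orbT.
Qed.

End SmallDegrees.

(** * Intervals *)

Section Intervals.
Local Open Scope ring_scope.

Lemma itvP (a b d : int) : ([set` `[a, b]]%classic : set int) d <-> a <= d <= b.
Proof. by rewrite /= in_setE /= in_itv. Qed.

(** Predecessors lead from the maximum down to lo; the empty set is an interval
    with reversed ends. *)
Lemma finite_interval_nat (A : set int) (P : nat -> Prop) (lo N : nat) :
    (forall d, A d <-> exists2 n, d = n%:Z & P n) ->
    (forall n, P n -> (lo <= n <= N)%N) -> (forall n, (lo < n)%N -> P n -> P n.-1) ->
  finite_interval A.
Proof.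
move=> AP bP dP; have [[n0 Pn0]|none] := pselect (exists n, P n); last first.
  exists 1, 0; apply/seteqP; split=> d.
    by move=> /AP[n _ Pn]; case: none; exists n.
  by move=> /itvP; lia.
have [M PM maxM] : exists2 M, P M & forall n, P n -> (n <= M)%N.
  suff H m : forall n, P n -> (N - n <= m)%N -> exists2 M, P M & forall n, P n -> (n <= M)%N.
    exact: (H _ n0 Pn0 (leqnn _)).
  elim: m => [|m IHm] n Pn ltm.
    by exists n => // n' Pn'; have := bP _ Pn'; lia.
  have [[n' [Pn' lt]]|max] := pselect (exists n', P n' /\ (n < n')%N).
    by apply: (IHm n' Pn'); have := bP _ Pn'; lia.
  by exists n => // n' Pn'; rewrite leqNgt; apply/negP => lt; apply: max; exists n'.
have down k : (lo <= M - k)%N -> P (M - k)%N.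
  elim: k => [|k IHk] le; first by rewrite subn0.
  have [e|lt] : (M - k.+1 = M - k \/ lo < M - k)%N by lia.
    by rewrite e in le *; apply: IHk.
  by rewrite subnS; apply: dP => //; apply: IHk; lia.
exists lo%:Z, M%:Z; apply/seteqP; split=> d; last move/itvP.
  by move=> /AP[n -> Pn]; apply/itvP; have := bP _ Pn; have := maxM _ Pn; lia.
case: d => n; last by lia.
move=> le; apply/AP; exists n => //.
have e : n = (M - (M - n))%N by lia.
by rewrite e; apply: down; rewrite -e; lia.
Qed.

End Intervals.

(** * Distances, lengths and catenary degrees as natural numbers *)

Section Translation.
Local Open Scope mset_scope.
Local Open Scope ring_scope.
Variable gT : finGroupType.
Implicit Types (S : {mset gT}) (z : {mset {mset gT}}).

Lemma lengthsP S l : lengths S l <-> exists2 k, l = k%:Z & has_length S k.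
Proof.
split=> [[z fz <-]|[_ -> [z fz <-]]]; last by exists z.
by exists (size z) => //; exists z.
Qed.

Lemma lengths_nat S (k : nat) : lengths S k%:Z <-> has_length S k.
Proof. by split=> [/lengthsP[j [->]]|h]; last by apply/lengthsP; exists k. Qed.

Lemma has_length_po S k : has_length S k -> product_one S.
Proof. by case=> z /fac_po. Qed.

Lemma distancesP S d : set_of_distances (lengths S) d <->
  exists2 e, d = e%:Z & (0 < e)%N /\ exists k, next_length k e S.
Proof.
split=> [[d0 [l Sl gap]]|[e -> [e0 [k [[Sk _ ge] Ske]]]]].
  have [k dl Sk] := (lengthsP S l).1 Sl; case: d => e in d0 gap *; last by [].
  exists e => //; split=> //; exists k; rewrite dl in gap.
  have Ske : has_length S (k + e).
    apply/lengths_nat; have : [set k%:Z; k%:Z + e%:Z]%classic (k%:Z + e%:Z) by right.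
    by rewrite -gap PoszD => -[].
  split=> //; split=> //; first by exists (k + e)%N => //; lia.
  move=> j Sj ltkj; rewrite leqNgt; apply/negP => ltj.
  have : [set k%:Z; k%:Z + e%:Z]%classic j%:Z.
    rewrite -gap; split; first exact/lengths_nat.
    by apply/itvP; lia.
  by case=> /=; lia.
split; first by lia.
exists k%:Z; first exact/lengths_nat.
apply/seteqP; split=> j.
  case=> /lengthsP[i -> Si] /itvP lei; have [ltki|] := ltnP k i.
    by right; rewrite /=; have := ge i Si ltki; lia.
  by left; rewrite /=; lia.
case=> ->; split; by [exact/lengths_nat | apply/itvP; lia].
Qed.

Lemma DeltaP d : Delta gT d <->
  exists2 e, d = e%:Z & (0 < e)%N /\ exists k S, next_length k e S.
Proof.
split=> [[S pS /distancesP[e -> [e0 [k Sk]]]]|[e -> [e0 [k [S Sk]]]]].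
  by exists e => //; split=> //; exists k, S.
exists S; first by have [[/has_length_po]] := Sk.
by apply/distancesP; exists e => //; split=> //; exists k.
Qed.

Lemma length_ge2 S k : has_length S 2 -> has_length S k -> (2 <= k)%N.
Proof.
case=> z fz sz [x fx sx]; rewrite ltnNge; apply/negP => k1.
rewrite -sx in k1; have e := fac_unique_small fx fz k1.
by rewrite e sz in k1.
Qed.

Lemma dalethP m : daleth_star gT m <->
  exists2 n, m = n%:Z & (2 < n)%N /\ exists S, next_length 2 (n - 2) S.
Proof.
split=> [[S [pS S2 _ [[/lengthsP[n -> Sn] n2] min]]]|[n -> [n2 [S [[S2 _ ge] Sn]]]]].
  have {}S2 := (lengths_nat S 2).1 S2; have le := length_ge2 S2 Sn.
  have lt : (2 < n)%N.
    by rewrite ltn_neqAle le andbT; apply/eqP => e; apply: n2; rewrite -e.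
  exists n => //; split=> //; exists S; split; last by rewrite subnKC.
  split=> //; first by exists n.
  move=> l Sl l2; rewrite subnKC //.
  suff : n%:Z <= l%:Z by lia.
  by apply: min; split; [exact/lengths_nat|move=> /= [e]; rewrite e in l2].
rewrite subnKC 1?ltnW // in Sn ge.
exists S; split; [exact: has_length_po Sn|exact/(lengths_nat S 2)| |].
  move=> e; have : [set 2]%classic n%:Z by rewrite -e; apply/lengths_nat.
  by move=> /= [] e2; rewrite e2 in n2.
split; first by split; [exact/lengths_nat|move=> /= [] e2; rewrite e2 in n2].
move=> _ [/lengthsP[l -> Sl] l2]; have le := length_ge2 S2 Sl.
have lt : (2 < l)%N.
  by rewrite ltn_neqAle le andbT; apply/eqP => e; apply: l2; rewrite -e.
by have := ge l Sl lt; lia.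
Qed.

Lemma cat_bound_mono S n m : (n <= m)%N -> cat_bound S n -> cat_bound S m.
Proof. by move=> le b z z' fz fz'; apply: connected_mono le (b z z' fz fz'). Qed.

Lemma chain_boundP S (n : nat) : chain_bound S n%:Z%:E <-> cat_bound S n.
Proof.
have e : (fun y y' : {mset {mset gT}} => ((fact_dist y y')%:Z%:E <= n%:Z%:E)%E) =2
    (fun y y' => (fact_dist y y' <= n)%N).
  by move=> y y'; rewrite lee_fin lez_nat.
split=> [[_ b] z z' fz fz'|b].
  by have [s [fs ps ls]] := b z z' fz fz'; exists s; split=> //; rewrite -(eq_path e).
split; first by rewrite lee_fin.
move=> z z' fz fz'; have [s [fs ps ls]] := b z z' fz fz'.
by exists s; split=> //; rewrite (eq_path e).
Qed.

(** The uniform bound shows that catenary degrees are finite, so they can be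
    described by natural numbers. *)
Lemma CaP N : Ca gT N <-> exists2 n : nat, N = n%:Z%:E &
  (1 < n)%N /\ exists S, cat_bound S n /\ ~ cat_bound S n.-1.
Proof.
split=> [[S [pS [cN min] N2]]|[n -> [n1 [S [bn nbn]]]]].
  have [n0 un0] := cat_bound_uniform gT.
  have := min n0%:Z%:E ((chain_boundP S n0).2 (un0 S)).
  case: N cN min N2 => [[n|n]| |] //= cN min N2 _.
  have n1 : (1 < n)%N by move: N2; rewrite lee_fin lez_nat.
  exists n => //; split=> //; exists S; split; first exact/chain_boundP.
  by move=> /chain_boundP/min; rewrite lee_fin lez_nat; lia.
have [z [z' [fz _ _ _]]] := not_cat_bound nbn.
exists S; split; [exact: fac_po fz| |by rewrite lee_fin lez_nat].
split; first exact/chain_boundP.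
case=> [[m|m]| |] bm; [|by have [] := bm|exact: leey|by have [] := bm].
rewrite lee_fin lez_nat leqNgt; apply/negP => ltm; apply: nbn.
by apply: cat_bound_mono ((chain_boundP S m).1 bm); lia.
Qed.

(** A chain that starts at length k and ends above it has to jump over the gap in a
    single step. *)
Lemma next_length_le S k e n : cat_bound S n -> (0 < e)%N -> next_length k e S -> (e <= n)%N.
Proof.
move=> b e0 [[[z fz sz] _ ge] [z' fz' sz']]; rewrite leqNgt; apply/negP => lt.
have := @connected_inv _ (fun y y' => (size y <= k)%N -> (size y' <= k)%N) S n z z'.
rewrite sz sz' => /(_ _ _ _ fz (b _ _ fz fz') (leqnn k)) H.
suff : (k + e <= k)%N by lia.
apply: H => // [y x u xy yu /xy/yu //|y y' fy fy' d leyk].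
rewrite leqNgt; apply/negP => lty'; have := ge _ (ex_intro2 _ _ y' fy' erefl) lty'.
by have := size_le_dist y' y; rewrite fact_dist_sym; lia.
Qed.

(** Sizes of atoms are bounded by the order of the group, so the supremum is a
    maximum. *)
Lemma davenport_max : exists M : nat, [/\ davenport gT = M%:Z%:E,
  exists2 A : {mset gT}, atom A & size A = M & forall A : {mset gT}, atom A -> (size A <= M)%N].
Proof.
have a1 : atom ([mset 1%g]%mset : {mset gT}).
  split.
  - by move=> /(congr1 (fun X : {mset gT} => size X)); rewrite size_mset1 size_mset0.
  - exact: po_mset1.
  move=> T U _ _ /(congr1 (fun X : {mset gT} => size X)).
  rewrite size_mset1 size_msetD => s.
  have [/mset_size0|T1] := posnP (size T); first by left.
  by right; apply: mset_size0; lia.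
have [M [A aA sA] maxM] : exists2 M : nat, exists2 A : {mset gT}, atom A & size A = M &
    forall A : {mset gT}, atom A -> (size A <= M)%N.
  pose p n := `[< exists2 A : {mset gT}, atom A & size A = n >].
  have ex : exists n, p n by exists 1%N; apply/asboolP; exists ([mset 1%g]%mset : {mset gT}); rewrite ?size_mset1.
  have ub n : p n -> (n <= #|gT|)%N by move=> /asboolP[A aA <-]; apply: atom_size.
  case: (ex_maxnP ex ub) => M /asboolP pM maxM; exists M => // A aA.
  by apply: maxM; apply/asboolP; exists A.
exists M; split=> //; last by exists A.
rewrite /davenport /supremum; case: ifPn => [/eqP e|_].
  suff : (set0 : set (\bar int)) ((size A)%:Z%:E) by [].
  by rewrite -e; exists A.
set D := [set _ | _ in _]%classic.
have sup : supremums D M%:Z%:E.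
  split=> [_ [B aB <-]|b ub].
    by rewrite lee_fin lez_nat; apply: maxM.
  by apply: ub; exists A => //; rewrite sA.
have : supremums D (xget 0%E (supremums D)) by apply: xgetPex; exists M%:Z%:E.
by move=> sup'; apply: is_subset1_supremums sup' sup.
Qed.

End Translation.

(** * Intervals from Property P *)

Section PropertyP.
Local Open Scope ring_scope.
Variable gT : finGroupType.
Hypothesis G3 : (2 < #|gT|)%N.

Lemma next_length_2_1 : exists S, @next_length gT 2 1 S.
Proof.
have [S [S2 S3 _]] := lengths_2_3 G3; exists S; split=> //; split=> //.
by exists 3%N.
Qed.

Lemma catenary_degree_3 : Ca gT 3%:Z%:E.
Proof.
have [S [[z fz sz] [z' fz' sz'] b]] := lengths_2_3 G3.
apply/CaP; exists 3%N => //; split=> //; exists S; split=> //.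
by apply: (not_cat_bound2 fz fz'); rewrite sz sz'.
Qed.

Hypothesis hP : property_P gT.

Lemma next_length_pred k e : (1 < e)%N -> (exists S, @next_length gT k e S) ->
  exists S, @next_length gT k e.-1 S.
Proof. by move=> e1 [S [gapS _]]; apply: gap_pred gapS. Qed.

Lemma Delta_interval : finite_interval (Delta gT) /\ is_min (Delta gT) 1%:Z.
Proof.
have [n0 un0] := cat_bound_uniform gT; split.
  apply: (finite_interval_nat (lo := 1) (N := n0) (@DeltaP gT)) => [e [e0 [k [S Sk]]]|e e1 [e0 [k Sk]]].
    by rewrite e0 (next_length_le (un0 S) e0 Sk).
  by split; [lia|exists k; apply: next_length_pred].
split; first by apply/DeltaP; exists 1%N => //; split=> //; exists 2%N; apply: next_length_2_1.
by move=> _ /DeltaP[e -> [e0 _]]; lia.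
Qed.

Lemma daleth_interval : finite_interval (daleth_star gT) /\ is_min (daleth_star gT) 3%:Z.
Proof.
have [n0 un0] := cat_bound_uniform gT; split.
  apply: (finite_interval_nat (lo := 3) (N := n0 + 2) (@dalethP gT)) => [n [n2 [S Sn]]|n n3 [n2 Sn]].
    by have := next_length_le (un0 S) _ Sn; lia.
  split; first by lia.
  by have -> : (n.-1 - 2 = (n - 2).-1)%N by [lia]; apply: next_length_pred => //; lia.
split; first by apply/dalethP; exists 3%N => //; split=> //; apply: next_length_2_1.
by move=> _ /dalethP[n -> [n2 _]]; lia.
Qed.

Lemma Ca_interval : [/\ ext_finite_interval (Ca gT),
  davenport gT = 3%:Z%:E -> is_min (Ca gT) 3%:Z%:E &
  (4%:Z%:E <= davenport gT)%E -> is_min (Ca gT) 2%:Z%:E].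
Proof.
have [M [dM [A aA sA] maxM]] := davenport_max gT.
have Ca2 : (3 < M)%N -> Ca gT 2%:Z%:E.
  rewrite -sA => lt; have [S bS] := catenary_degree_2 aA lt.
  by apply/CaP; exists 2%N => //; split=> //; exists S.
have Ca_ge3 (n : nat) : (M <= 3)%N -> Ca gT n%:Z%:E -> (2 < n)%N.
  move=> M3 /CaP[m [->] [m1 [S [b nb]]]].
  rewrite ltn_neqAle m1 andbT; apply/eqP => e; case: nb; rewrite -e in b *.
  by apply: short_atoms_degree b => B aB; apply: leq_trans (maxM B aB) M3.
split.
- have [n0 un0] := cat_bound_uniform gT.
  exists [set n%:Z | n in [set n : nat | Ca gT n%:Z%:E]]%classic; last first.
    apply/seteqP; split=> [N /[dup] /CaP[n -> _] CaN|_ [_ [n CaN <-] <-] //].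
    by exists n%:Z => //; exists n.
  have CaN n : Ca gT n%:Z%:E -> (1 < n)%N /\ exists S : {mset gT}%mset, ~ cat_bound S n.-1.
    by move=> /CaP[m [->] [m1 [S [_ nb]]]]; split=> //; exists S.
  apply: (finite_interval_nat (P := fun n => Ca gT n%:Z%:E)
      (lo := if (3 < M)%N then 2 else 3) (N := n0)).
  + by move=> d; split=> [[n /= CaNn <-]|[n -> CaNn]]; exists n.
  + move=> n Cn; have [n1 [S nb]] := CaN n Cn; apply/andP; split.
      by case: ltnP => // M3; apply: Ca_ge3.
    rewrite leqNgt; apply/negP => lt; apply: nb; apply: cat_bound_mono (un0 S).
    by lia.
  + move=> n lo Cn; have [[e4|e3]|n4] : (n = 4 \/ n = 3) \/ (4 < n)%N.
      by have := (CaN n Cn).1; move: lo; case: ifP; lia.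
    (* The step from 4 to 3 is not covered by the descent, and the one from 3 to 2
       needs an atom with at least four terms. *)
    * by rewrite e4; apply: catenary_degree_3.
    * by rewrite e3 in lo *; apply: Ca2; move: lo; case: ifP.
    have [n1 [S nb]] := CaN n Cn.
    have [|S' bS'] := catenary_pred hP _ nb; first by lia.
    by apply/CaP; exists n.-1 => //; split; [lia|exists S'].
- rewrite dM => -[eM]; split; first exact: catenary_degree_3.
  move=> N CN; have [n eN _] := (CaP _ _).1 CN; rewrite eN in CN *.
  by rewrite lee_fin lez_nat; apply: Ca_ge3 CN; rewrite eM.
- rewrite dM lee_fin lez_nat => M4; split; first exact: Ca2.
  by move=> _ /CaP[n -> [n1 _]]; rewrite lee_fin lez_nat.
Qed.

End PropertyP.

(** * Groups with a commutator subgroup of order at most two *)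

Section SmallDerived.
Local Open Scope mset_scope.
Variable gT : finGroupType.
Implicit Types (S T U V W X : {mset gT}) (g h a b u v : gT) (z : {mset {mset gT}}).

Notation D := ([set: gT]^`(1)%G).

Lemma commg_der a b : [~ a, b]%g \in D.
Proof. by apply: mem_commg; rewrite inE. Qed.

Hypothesis D2 : #|D| <= 2.

Lemma der_unique k l : k \in D -> l \in D -> k != 1%g -> l != 1%g -> k = l.
Proof.
move=> kD lD k1 l1; apply/eqP; apply: contraLR D2 => kl; rewrite -ltnNge.
have <- : #|[set 1%g; k; l]| = 3.
  by rewrite -finset.setUA cardsU1 cards2 !inE kl !(eq_sym 1%g) (negPf k1) (negPf l1).
by apply/subset_leq_card/fintype.subsetP => x; rewrite !inE => /orP[/orP[]|] /eqP ->.
Qed.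

Lemma der_central k x : k \in D -> commute k x.
Proof.
move=> kD; have [->|k1] := eqVneq k 1%g; first exact/commute_sym/commute1.
apply/commute_sym/commgP; rewrite -invg_comm invg_eq1; apply/conjg_fixP.
apply: der_unique => //; last by rewrite conjg_eq1.
by rewrite memJ_norm // (fintype.subsetP (normal_norm (der_normal 1 [set: gT]))) ?inE.
Qed.

Lemma der_perm (s t : seq gT) : perm_eq s t -> (\prod_(g <- s) g)%g \in D ->
  (\prod_(g <- t) g)%g \in D.
Proof.
move=> pst sD; have [k kD ->] := prod_perm der_central (fun x y _ _ => commg_der x y) pst.
exact: groupM.
Qed.

(** Exchanging two non-commuting neighbours multiplies a product by the
    non-trivial commutator, so both elements of the commutator subgroup are
    products of the sequence. *)
Lemma po_noncommuting S s a b : perm_eq s S -> (\prod_(g <- s) g)%g \in D ->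
  a \in S -> b \in S -> ~ commute a b -> product_one S.
Proof.
move=> ps sD /mset_mem[S' dS]; rewrite dS in_mset1D => /orP[/eqP-> [] //|].
case/mset_mem=> T dS' nab; rewrite dS' in dS *.
have dSt : S = seq_mset (a :: b :: T) by rewrite !mset_cons seq_mset_id.
have pt : perm_eq s (a :: b :: T) by rewrite (perm_trans ps) // dSt perm_eq_seq_mset.
have tD := der_perm pt sD.
have [t1|t1] := eqVneq (\prod_(g <- a :: b :: T) g)%g 1%g; first by rewrite -dS dSt; apply: po_seq.
have -> : a +` (b +` T) = seq_mset (b :: a :: T) by rewrite !mset_cons seq_mset_id msetDCA.
apply: po_seq; have c1 : [~ a, b]%g != 1%g by apply/negP => /commgP.
have e := der_unique tD (commg_der a b) t1 c1.
move: e (der_central (\prod_(g <- T) g)%g (commg_der a b)) (commgC a b).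
rewrite !big_cons; move: [~ a, b]%g => c e cc eab.
apply: (mulIg c); rewrite mul1g -[RHS]e -!mulgA -(cc : c * _ = _)%g !mulgA.
by rewrite eab.
Qed.

(** If 2x and 3x are product-one sequences then x is a sequence, and modulo the
    commutator subgroup the square and the cube of its product p are trivial, so p is.
    If two terms do not commute this suffices; otherwise p^2 = p^3 = 1. *)
Lemma seminormal_small_derived : seminormal (@product_one_monoid gT).
Proof.
move=> x _ [S2 p2 e2] [S3 p3 e3].
have x_ge0 g : (0 <= x g)%R.
  by move/ffunP/(_ g): e2; rewrite !ffunE; move: (S2 g) (x g); clear; lia.
pose s := flatten [seq nseq `|x g|%N g | g <- enum gT].
pose S := seq_mset s.
have Sx g : (S g : int) = x g.
  rewrite mset_seqE /s count_flatten -map_comp sumn_map.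
  rewrite (eq_bigr (fun h => (h == g) * `|x h|%N)); last by move=> h _; rewrite /= count_nseq.
  rewrite big_enum (bigD1 g) //= eqxx mul1n big1 ?addn0; last by move=> h /negPf->.
  by rewrite gez0_abs.
clearbody s.
have dS2 : S2 = S `+` S.
  apply/msetP => g; move/ffunP/(_ g): e2; rewrite !ffunE msetE2 -Sx.
  by move: (S2 g) (S g); clear; lia.
have dS3 : S3 = S `+` S `+` S.
  apply/msetP => g; move/ffunP/(_ g): e3; rewrite !ffunE !msetE2 -Sx.
  by move: (S3 g) (S g); clear; lia.
exists S; last by apply/ffunP => g; rewrite ffunE Sx.
pose p := (\prod_(g <- s) g)%g.
have D1 t : product_one t -> forall r, t = seq_mset r -> (\prod_(g <- r) g)%g \in D.
  move=> /po_seqP[q -> pq] r /eq_seq_msetP qr.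
  by apply: (der_perm qr); rewrite pq group1.
have pp2 : (p * p)%g \in D.
  by have := D1 _ p2 (s ++ s); rewrite dS2 seq_mset_cat big_cat => /(_ erefl).
have pp3 : (p * p * p)%g \in D.
  by have := D1 _ p3 (s ++ s ++ s); rewrite dS3 !seq_mset_cat msetDA !big_cat /= mulgA => /(_ erefl).
have pD : p \in D by rewrite -(groupMl _ pp2).
have [[a [b [aS [bS nab]]]]|com] :=
    pselect (exists a b, a \in S /\ b \in S /\ ~ commute a b).
  have pS : perm_eq s S by rewrite mset_seq_mset.
  exact: po_noncommuting pS pD aS bS nab.
have {}com : {in s ++ s ++ s &, forall a b, commute a b}.
  move=> a b; rewrite !mem_cat !orbb => aS bS; apply: contrapT => nab.
  by apply: com; exists a, b; rewrite !mem_seq_mset.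
have D1' t : product_one t -> forall r, t = seq_mset r -> {subset r <= s} -> (\prod_(g <- r) g = 1)%g.
  move=> /po_seqP[q -> pq] r /eq_seq_msetP qr rs.
  apply: etrans pq; apply: prod_perm_commute (qr) => u v uq vq.
  by apply: com; rewrite !mem_cat rs // -(perm_mem qr).
have e1 : (p * p = 1)%g.
  have := D1' _ p2 (s ++ s); rewrite dS2 seq_mset_cat big_cat; apply=> // u.
  by rewrite mem_cat orbb.
have e2' : (p * p * p = 1)%g.
  have := D1' _ p3 (s ++ s ++ s); rewrite dS3 !seq_mset_cat msetDA !big_cat /= mulgA; apply=> // u.
  by rewrite !mem_cat !orbb.
by apply: po_seq; move: e2'; rewrite e1 mul1g.
Qed.

(** Suppose h1, h2, T has three atoms.  If h1 and h2 lie in different ones,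
    these merge, and the atom (h1 h2) T decomposes.  Otherwise T contains
    product-one parts V2 and c2, and W consists of h1 h2 and the rest of T.  Since (h1 h2) T is
    an atom, W V2 and W c2 do not have product one, so their terms commute
    pairwise, while those of W V2 c2 do not.  Some term of V2
    thus does not commute with some term of c2, and the terms of W commute
    with both, so they are central; then W has product one, a contradiction. *)
Lemma property_P_small_derived :
    (forall a b, ~ commute a b -> forall u, commute u a -> commute u b ->
       forall v, commute u v) ->
  property_P gT.
Proof.
move=> hZ g h1 h2 T aU dg z fz; rewrite leqNgt; apply/negP => z3.
have [|V1 V1z h1V] := @mem_concat _ h1 z; first by rewrite (fac_concat fz) mset1D1.
have [z1 dz] := mset2_mem V1z; have [X dV1] := mset_mem h1V.
have pV1 := atom_po (fac_atom fz V1z).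
rewrite dz in fz z3; rewrite size_mset1D ltnS in z3.
have eS := fac_concat fz; rewrite concat1D dV1 -msetDA in eS.
have {eS} e1 := mset1DI (esym eS).
have fz1 : factorizations (concat z1) z1 by apply: (@fac_subr _ _ [mset V1]); exact: fz.
have ne z' : factorizations (concat z') z' -> 0 < size z' -> concat z' <> mset0.
  move=> f s0 c0; have := atomic_size (fun A => fac_atom f (A := A)) s0.
  by rewrite c0 size_mset0.
have gn0 Y : g +` Y <> mset0.
  by move/(congr1 (fun Z : {mset gT} => size Z)); rewrite size_mset1D size_mset0.
have : h2 \in X `+` concat z1 by rewrite -e1 mset1D1.
rewrite in_msetD => /orP[/(msetD1_mem e1)[X' dX dT]|h2z1]; last first.
  have [V2 V2z h2V] := mem_concat h2z1.
  have [z2 dz1] := mset2_mem V2z; have [Y dV2] := mset_mem h2V.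
  have pV2 := atom_po (fac_atom fz1 V2z).
  rewrite dz1 in fz1 z3; rewrite size_mset1D ltnS in z3.
  have fz2 : factorizations (concat z2) z2 by apply: (@fac_subr _ _ [mset V2]); exact: fz1.
  have dT : T = X `+` Y `+` concat z2.
    by apply: (@mset1DI _ h2); rewrite e1 dz1 concat1D dV2 -!msetDA msetDCA.
  rewrite dV1 in pV1; rewrite dV2 in pV2; rewrite dg dT msetDA in aU.
  have := atom_irr aU (po_join pV1 pV2) (fac_po fz2).
  by rewrite -dg; case=> [/gn0//|]; apply: ne.
have [|V2 [z2 dz1]] := @mset2_neq0_mem _ z1.
  by move=> z10; rewrite z10 size_mset0 in z3.
rewrite dz1 in fz1 z3 dT; rewrite size_mset1D ltnS in z3; rewrite concat1D in dT.
have fz2 : factorizations (concat z2) z2 by apply: (@fac_subr _ _ [mset V2]); exact: fz1.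
have aV2 : atom V2 by apply: (fac_atom fz1); rewrite mset1D1.
have pc2 := fac_po fz2; have nc2 := ne _ fz2 z3; have pV2 := atom_po aV2.
have nV2 := atom_neq0 aV2.
move: (concat z2) pc2 nc2 dT => c2 pc2 nc2 dT {z3 fz2 fz1 dz1 V1z h1V e1 dz fz z z1 z2 ne}.
pose W := g +` X'; have dU : g +` T = W `+` (V2 `+` c2) by rewrite dT msetDA.
rewrite dU in aU.
have [q2 dq2 pq2] := (po_seqP V2).1 pV2; have [q3 dq3 pq3] := (po_seqP c2).1 pc2.
pose w := g :: X'; have dW : W = seq_mset w by rewrite mset_cons seq_mset_id.
pose v1 := [:: h1, h2 & X'].
have dV1s : V1 = seq_mset v1 by rewrite dV1 dX !mset_cons seq_mset_id.
have ew : (\prod_(u <- w) u = \prod_(u <- v1) u)%g by rewrite !big_cons dg mulgA.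
have [q1 dq1 pq1] := (po_seqP V1).1 pV1.
have pqv : perm_eq q1 v1 by apply/eq_seq_msetP; rewrite -dq1.
have wD : (\prod_(u <- w) u)%g \in D.
  by rewrite ew; apply: (der_perm pqv); rewrite pq1 group1.
have nW : ~ product_one W.
  move=> pW; case: (atom_irr aU pW (poD pV2 pc2)) => [/gn0 //|].
  by case/msetD_eq0.
have nWV : ~ product_one (W `+` V2).
  rewrite msetDA in aU => pWV; case: (atom_irr aU pWV pc2) => //.
  by case/msetD_eq0 => /gn0.
have nWc : ~ product_one (W `+` c2).
  rewrite (msetDC V2) msetDA in aU => pWc; case: (atom_irr aU pWc pV2) => //.
  by case/msetD_eq0 => /gn0.
have com2 Y q : Y = seq_mset q -> (\prod_(u <- q) u = 1)%g -> ~ product_one (W `+` Y) ->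
    forall a b, a \in W `+` Y -> b \in W `+` Y -> commute a b.
  move=> dY pq nWY a b aWY bWY; apply: contrapT => nab; apply: nWY.
  apply: (po_noncommuting (s := w ++ q)) nab => //; last by rewrite big_cat /= pq mulg1.
  by rewrite mset_seq_mset seq_mset_cat -dW dY.
have comV := com2 V2 q2 dq2 pq2 nWV; have comc := com2 c2 q3 dq3 pq3 nWc.
have [a [b [aV [bc nab]]]] : exists a b, a \in V2 /\ b \in c2 /\ ~ commute a b.
  apply: contrapT => none; apply: nW; rewrite dW; apply: po_seq.
  have [r dr pr] := (po_seqP _).1 (atom_po aU).
  have pwr : perm_eq r (w ++ q2 ++ q3).
    by apply/eq_seq_msetP; rewrite -dr !seq_mset_cat -dW -dq2 -dq3.
  have mw u : (u \in w) = (u \in W) by rewrite dW mem_seq_mset.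
  have m2 u : (u \in q2) = (u \in V2) by rewrite dq2 mem_seq_mset.
  have m3 u : (u \in q3) = (u \in c2) by rewrite dq3 mem_seq_mset.
  have : (\prod_(u <- w ++ q2 ++ q3) u = \prod_(u <- r) u)%g.
    apply: prod_perm_commute (pwr) => a b; rewrite !(perm_mem pwr) !mem_cat !mw !m2 !m3.
    have cVc a' b' : a' \in V2 -> b' \in c2 -> commute a' b'.
      by move=> aV bc; apply: contrapT => nab; apply: none; exists a', b'.
    case/or3P=> ia /or3P[] ib; try by [apply: comV; rewrite in_msetD ?ia ?ib ?orbT
      | apply: comc; rewrite in_msetD ?ia ?ib ?orbT | apply: cVc
      | apply/commute_sym/cVc].
  by rewrite !big_cat /= pq2 pq3 !mulg1 pr.
have cW u : u \in W -> forall v, commute u v.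
  move=> uW; apply: (hZ a b nab); first by apply: comV; rewrite in_msetD ?uW ?aV ?orbT.
  by apply: comc; rewrite in_msetD ?uW ?bc ?orbT.
apply: nW; rewrite dW; apply: po_seq; rewrite ew.
apply: etrans pq1; apply: prod_perm_commute (pqv).
have cg v : commute g v by apply: cW; rewrite mset1D1.
have cX u : u \in X' -> forall v, commute u v by move=> uX; apply: cW; rewrite in_mset1D uX orbT.
have ch : commute h1 h2.
  by apply: (mulgI h1); have := cg h1; rewrite /commute dg !mulgA => <-.
move=> u v; rewrite !(perm_mem pqv) !inE => /or3P[/eqP->|/eqP->|/cX //] /or3P[/eqP->|/eqP->|/cX cv] //;
  exact/commute_sym.
Qed.

End SmallDerived.

(** * Minimal non-abelian Sylow 2-subgroups *)

Section MinimalNonabelian.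
Local Open Scope group_scope.
Variable gT : finGroupType.
Implicit Types (a b u v x y : gT).

Notation D := ([set: gT]^`(1)%G).

Hypothesis D2 : #|D| = 2.

Let D2' : #|D| <= 2. Proof. by rewrite D2. Qed.

(** Commutation with a fixed element is a homomorphism into the commutator subgroup,
    which has order 2. *)
Lemma odd_elt_central x y : 2^'.-elt x -> commute x y.
Proof.
move=> ox; apply/commgP; set c := [~ x, y]%g.
have cD : c \in D by apply: commg_der.
have cx : commute x c by apply/commute_sym/(der_central D2').
have c_ox : (c ^+ #[x] = 1)%g by rewrite -commXg // expg_order comm1g.
rewrite -order_eq1 -dvdn1; have : coprime 2 #[x].
  by rewrite coprime_sym; have := @p'nat_coprime 2 #[x] 2 ox; apply.
rewrite /coprime => /eqP <-; rewrite dvdn_gcd; apply/andP; split.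
  by rewrite -D2 order_dvdG.
by rewrite order_dvdn c_ox.
Qed.

(** Parts of odd order are central, so nothing is lost by passing to 2-parts.
    Those of a and b do not commute, so they generate the Sylow 2-subgroup,
    which is normal because it contains the commutator subgroup. *)
Lemma minimal_nonabelian_center :
    (forall P : {group gT}, 2.-Sylow([set: gT]) P -> minimal_nonabelian P) ->
  forall a b, ~ commute a b -> forall u, commute u a -> commute u b -> forall v, commute u v.
Proof.
move=> hP a b nab u ua ub v.
have [P sylP] := Sylow_exists 2 [set: gT]; have [nabP minP] := hP P sylP.
have DP : D \subset P.
  have pD : 2.-group D by rewrite /pgroup D2.
  exact: fintype.subset_trans (pcore_max pD (der_normal 1 _)) (pcore_sub_Hall sylP).
have nP : P <| [set: gT] by apply: (sub_der1_normal DP); apply: finset.subsetT.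
have inP x : x.`_2 \in P by rewrite (mem_normal_Hall sylP nP) ?inE ?p_elt_constt.
have reduce x y : commute x.`_2 y -> commute x y.
  move=> cxy; rewrite -(consttC 2 x); apply/commute_sym/commuteM; apply/commute_sym => //.
  exact/odd_elt_central/p_elt_constt.
have c2 x y : commute x y -> commute x y.`_2.
  by move=> cxy; rewrite /constt; apply: commuteX.
pose H := <<[set a.`_2; b.`_2]>>%G.
have sHP : H \subset P by rewrite gen_subG finset.subUset !finset.sub1set !inP.
have nabH : ~~ abelian H.
  apply/negP => abH; apply: nab; apply/reduce/commute_sym/reduce/commute_sym.
  by apply: (centsP abH); rewrite mem_gen // !inE eqxx ?orbT.
have HP : P \subset H.
  by apply: contraNT nabH => nPH; apply: minP; rewrite properE sHP.
have cuH : H \subset 'C[u]%g.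
  rewrite gen_subG finset.subUset !finset.sub1set; apply/andP.
  by split; apply/cent1P/commute_sym/c2.
apply/commute_sym/reduce; apply/cent1P.
by apply: (fintype.subsetP cuH); apply: (fintype.subsetP HP).
Qed.

End MinimalNonabelian.

Local Open Scope ring_scope.
Local Open Scope ereal_scope.
Local Open Scope group_scope.

Theorem theorem3p9 (gT : finGroupType) (hG : (3 <= #|gT|)%N) :
  (property_P gT ->
     [/\ finite_interval (Delta gT) /\ is_min (Delta gT) 1%:Z,
         finite_interval (daleth_star gT) /\ is_min (daleth_star gT) 3%:Z &
         [/\ ext_finite_interval (Ca gT),
             davenport gT = 3%:Z%:E -> is_min (Ca gT) 3%:Z%:E &
             (4%:Z%:E <= davenport gT)%E -> is_min (Ca gT) 2%:Z%:E]])
  /\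
  (abelian [set: gT]%G \/
   (#|[set: gT]%G^`(1)| = 2%N /\
    forall P : {group gT}, 2.-Sylow([set: gT]%G) P -> minimal_nonabelian P) ->
     [/\ seminormal (@product_one_monoid gT),
         finite_interval (Delta gT),
         finite_interval (daleth_star gT) &
         ext_finite_interval (Ca gT)]).
Proof.
have part1 (hP : property_P gT) := And3 (Delta_interval hG hP) (daleth_interval hG hP)
  (Ca_interval hG hP).
split=> [//|hyp].
have [D2 hP] : (#|[set: gT]^`(1)%G| <= 2)%N /\ property_P gT.
  case: hyp => [abG|[D2 minP]].
    have D2 : (#|[set: gT]^`(1)%G| <= 2)%N by rewrite /= (derG1P abG) cards1.
    split=> //; apply: (property_P_small_derived D2) => a b []; exact: (centsP abG).
  have D2' : (#|[set: gT]^`(1)%G| <= 2)%N by rewrite /= D2.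
  by split=> //; apply: (property_P_small_derived D2'); apply: (minimal_nonabelian_center D2 minP).
have [[iD _] [iL _] [iC _ _]] := part1 hP.
by split=> //; apply: seminormal_small_derived D2.
Qed.
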